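(* Let $\alpha\ge 12\exp(-100d)$ be given. Consider the Bernoulli model described in the context and the parameter spaces $\mathcal A(a,k)$ and $\mathcal A(a,k_0)$ with $1\le k_0<k\le m$. Assume that the noise assumption in the context is fulfilled, that $\sigma>0$ is known and that $n\ge m\log(d)$. Consider the testing problem $$H_0:M\in\mathcal A(a,k_0)\quad\text{against}\quad H_1:M\in\mathcal A(a,k),\ \|M-\mathcal A(a,k_0)\|_F^2\ge\rho^2 .$$ There is a constant $C=C(\alpha,a,U,\sigma)>0$ such that if $$\rho^2\ge C\,\frac{m_1m_2k_0d}{n},$$ then the test $\Psi_n=\mathbf 1_{\{T_n>u_\alpha\}}$, with $T_n$ and $u_\alpha$ as defined in the context, satisfies $$\sup_{M\in\mathcal A(a,k_0)}\mathbb E_{M,\sigma}[\Psi_n]+\sup_{M\in\mathcal A(a,k),\ \|M-\mathcal A(a,k_0)\|_F^2\ge\rho^2}\mathbb E_{M,\sigma}[1-\Psi_n]\le\alpha .$$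
   Context: Notation. $m=\min(m_1,m_2)$, $d=m_1+m_2$, $\|\cdot\|_F$ is the Frobenius norm, $\|A\|_\infty=\max_{i,j}|A_{ij}|$, $\mathcal A(a,k)=\{A\in\mathbb R^{m_1\times m_2}:\|A\|_\infty\le a,\ \mathrm{rank}(A)\le k\}$ with $a>0$, and $\|M-\mathcal A(a,k_0)\|_F=\inf_{A\in\mathcal A(a,k_0)}\|M-A\|_F$. Bernoulli model. Given $n\le m_1m_2$, put $p=n/(m_1m_2)$; the $B_{ij}$ are i.i.d. Bernoulli($p$), independent of the noise $(\epsilon_{ij})$, and one observes $B_{ij}$ and $Y_{ij}=B_{ij}(M_{ij}+\epsilon_{ij})$ for $1\le i\le m_1$, $1\le j\le m_2$. $\mathbb P_{M,\sigma}$, $\mathbb E_{M,\sigma}$ denote the law of the data and the expectation, with matrix $M$ and noise variance $\sigma^2$ ($\mathbb P_\sigma$ when the event does not depend on $M$). Noise assumption: the $\epsilon_{ij}$ are independent, $\mathbb E\epsilon_{ij}=0$, $\mathbb E\epsilon_{ij}^2=\sigma^2$, and $\max_{i,j}|\epsilon_{ij}|\le U$ almost surely, where $U>0$ is a constant. Test statistic and quantile constant: $$T_n=\inf_{A\in\mathcal A(a,k_0)}\left|\frac1{\sqrt{2n}}\sum_{i,j}B_{ij}\big((Y_{ij}-A_{ij})^2-\sigma^2\big)\right|,$$ and $u_\alpha$ is a constant depending only on $\alpha,\sigma,U$ such that $$\mathbb P_\sigma\left(\frac1{\sqrt{2n}}\Big|\sum_{i,j}B_{ij}(\epsilon_{ij}^2-\mathbb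 E\epsilon_{ij}^2)\Big|>u_\alpha\right)\le\alpha/3;$$ for example $u_\alpha=\sigma\sqrt{3(U^2-\sigma^2)/(2\alpha)}$ is admissible. *)

(* Defs.v *)
From HB Require Import structures.
From mathcomp Require Import all_boot all_order all_algebra.
From mathcomp Require Import all_classical all_reals all_analysis.

Set Implicit Arguments.
Unset Strict Implicit.
Unset Printing Implicit Defensive.

Import Order.TTheory GRing.Theory Num.Theory.
Import numFieldNormedType.Exports.

Local Open Scope classical_set_scope.
Local Open Scope ring_scope.

Section matrices.
Context {R : realType} {m1 m2 : nat}.
Implicit Types A M : 'M[R]_(m1, m2).

Definition frob_norm A : R := Num.sqrt (\sum_i \sum_j A i j ^+ 2).

(* [mx_norm] is the largest absolute value of an entry. *)
Definition calA (a : R) (k : nat) : set 'M[R]_(m1, m2) :=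
  [set A | mx_norm A <= a /\ (\rank A <= k)%N].

Definition frob_dist M (S : set 'M[R]_(m1, m2)) : R :=
  inf [set frob_norm (M - A) | A in S].

Definition alternative (a : R) (k0 k : nat) (rho : R) : set 'M[R]_(m1, m2) :=
  [set M | calA a k M /\ rho ^+ 2 <= frob_dist M (calA a k0) ^+ 2].

End matrices.

Section independence.
Context {d : measure_display} {T : measurableType d} {R : realType}.
Variable P : probability T R.

Definition sigma_of {d'} {T' : measurableType d'} (X : T -> T') :
    set (set T) :=
  preimage_set_system setT X measurable.

Definition sigma_of_family {d'} {T' : measurableType d'} {I : Type}
    (X : I -> T -> T') : set (set T) :=
  <<s \bigcup_i sigma_of (X i) >>.

Definition mutually_independent {d'} {T' : measurableType d'} {I : finType}
    (X : I -> T -> T') : Prop :=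
  forall (J : {set I}) (A : I -> set T),
    (forall i, i \in J -> sigma_of (X i) (A i)) ->
    P (\bigcap_(i in [set` J]) A i) = (\prod_(i in J) P (A i))%E.

Definition independent_families {d1 d2}
    {T1 : measurableType d1} {T2 : measurableType d2} {I1 I2 : Type}
    (X : I1 -> T -> T1) (Y : I2 -> T -> T2) : Prop :=
  forall A E : set T, sigma_of_family X A -> sigma_of_family Y E ->
    P (A `&` E) = (P A * P E)%E.

End independence.

Section bernoulli_model.
Context {R : realType} {m1 m2 : nat}.
Context {d : measure_display} {T : measurableType d}.
Variable P : probability T R.

Record noise_assumption (sigma U : R)
    (eps : 'I_m1 -> 'I_m2 -> {RV P >-> R}) : Prop := NoiseAssumption {
  noise_indep :
    mutually_independent P (fun ij : 'I_m1 * 'I_m2 => eps ij.1 ij.2) ;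
  noise_mean : forall i j, ('E_P[eps i j] = 0)%E ;
  noise_variance : forall i j, ('E_P[fun w => (eps i j w ^+ 2)%R] = (sigma ^+ 2)%:E)%E ;
  noise_bounded : {ae P, forall w, forall i j, `|eps i j w| <= U}
}.

Record bernoulli_sampling (n : nat)
    (B : 'I_m1 -> 'I_m2 -> {RV P >-> bool})
    (eps : 'I_m1 -> 'I_m2 -> {RV P >-> R}) : Prop := BernoulliSampling {
  sampling_law : forall i j,
    distribution P (B i j) =1 bernoulli_prob (n%:R / (m1 * m2)%:R : R) ;
  sampling_indep :
    mutually_independent P (fun ij : 'I_m1 * 'I_m2 => B ij.1 ij.2) ;
  sampling_noise_indep :
    independent_families P (fun ij : 'I_m1 * 'I_m2 => B ij.1 ij.2)
      (fun ij : 'I_m1 * 'I_m2 => eps ij.1 ij.2)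
}.

Variables (B : 'I_m1 -> 'I_m2 -> {RV P >-> bool}).
Variables (eps : 'I_m1 -> 'I_m2 -> {RV P >-> R}).

(* The observed values when the matrix is [M]. All the laws indexed by [M] are
   realized on [T] with the same sampling indicators and the same noise. *)
Definition obs (M : 'M[R]_(m1, m2)) (i : 'I_m1) (j : 'I_m2) (w : T) : R :=
  (B i j w)%:R * (M i j + eps i j w).

Definition test_stat (n : nat) (sigma a : R) (k0 : nat) (M : 'M[R]_(m1, m2))
    (w : T) : R :=
  inf [set `|(Num.sqrt (2 * n%:R))^-1 *
             \sum_i \sum_j (B i j w)%:R *
                ((obs M i j w - A i j) ^+ 2 - sigma ^+ 2)|
      | A in calA a k0].

Definition noise_stat (n : nat) (w : T) : R :=
  (Num.sqrt (2 * n%:R))^-1 *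
  `|\sum_i \sum_j (B i j w)%:R *
      (eps i j w ^+ 2 - fine ('E_P[fun w' => (eps i j w' ^+ 2)%R])%E)|.

Definition test (n : nat) (sigma a : R) (k0 : nat) (u : R)
    (M : 'M[R]_(m1, m2)) : T -> R :=
  \1_[set w | u < test_stat n sigma a k0 M w].

(* Both expectations below lie in [0, 1]. The real [sup] is therefore the
   supremum, and it is 0 when the index set is empty (an [ereal_sup] would be
   -oo if no matrix satisfies the alternative). *)
Definition type1_risk n sigma a k0 u : R :=
  sup [set fine ('E_P[test n sigma a k0 u M])%E | M in calA a k0].

Definition type2_risk n sigma a k0 k u rho : R :=
  sup [set fine ('E_P[fun w => (1 - test n sigma a k0 u M w)%R])%E
      | M in alternative a k0 k rho].

End bernoulli_model.

(* Main.v *)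
Require Import Defs.
From HB Require Import structures.
From mathcomp Require Import all_boot all_order all_algebra.
From mathcomp Require Import ring lra zify.
From mathcomp Require Import all_classical all_reals all_analysis.
From mathcomp Require Import measurable_realfun.

Set Implicit Arguments.
Unset Strict Implicit.
Unset Printing Implicit Defensive.

Import Order.TTheory GRing.Theory Num.Theory.
Import numFieldNormedType.Exports.

Local Open Scope ring_scope.

(* If M lies in the null class, T_n is at most the noise statistic. Otherwise put
   D = M - A: on the sampled entries, the residuals at A sum to
   |D|_B^2 + 2 <B eps, D> up to the noise statistic, and this has to be at least
   p |D|_F^2 / 2, with probability 1 - alpha/3, for all A in the null class at once.
   Since the constant may depend on alpha, Markov's inequality is enough, and after
   normalizing D to D / |D|_F the deviation process is controlled in mean without
   peeling: a contraction principle linearizes the squares, and conditionally on eps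
   the noise is replaced by random signs with conditional mean eps / U. Splitting D
   through a near-projection A0 of M leaves a fixed matrix, which contributes
   sqrt p |M - A0|_F, and A0 - A, of rank at most 2 k0. So everything reduces to
   E |xi o B|_op <= K sqrt (p d) for sparse sign matrices, p max(m1, m2) >= log d.
   This is the moment method in the form of Bandeira and van Handel: the trace moment
   counts even closed walks, which are compared with those of a full sign matrix of
   size about p d, and the norm of the latter is bounded by a net. *)

(** * Finite product laws and sparse random signs *)

(** The rate comes out of the normalization. With delta the distance of M to the null class, the
    entries of D / |D|_F are at most 2a / delta, so contraction costs a factor of order a / delta,
    the noise costs U / delta, and the linear process that remains is of order sqrt (p k0 d).
    Markov's inequality asks that the product be at most a multiple of alpha p, that is delta^2 >= C
    k0 d / p, which is C m1 m2 k0 d / n.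

    Suprema over the uncountable null class raise measurability questions on the sample space. They
    are therefore taken on a finite space of configurations (sampling bit, sign), where an
    expectation is a weighted sum; only a dominating function [h] of the configuration is
    transported to the data, as a finite combination of measurable weights.

    The comparison of walks loses a factor 1 / p, because a connected graph may have one vertex more
    than edges. At moment order 2q with q >= log d this factor is at most 4 ^ q and disappears in
    the root; this is where n >= m log d enters. The comparison matrix has size 2q + 1, so the
    cardinality of a net, exponential in q, is harmless as well. *)

Section ProductLaw.
Context {R : realFieldType} {I V : finType}.
Variable mu : V -> R.
Implicit Types F G : {ffun I -> V} -> R.

Definition pexp F : R := \sum_(x : {ffun I -> V}) (\prod_i mu (x i)) * F x.

Lemma eq_pexp F G : F =1 G -> pexp F = pexp G.
Proof. by move=> FG; apply: eq_bigr => x _; rewrite FG. Qed.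

Lemma pexpD F G : pexp (fun x => F x + G x) = pexp F + pexp G.
Proof. by rewrite -big_split/=; apply: eq_bigr => x _; rewrite mulrDr. Qed.

Lemma pexpZ c F : pexp (fun x => c * F x) = c * pexp F.
Proof. by rewrite mulr_sumr; apply: eq_bigr => x _; rewrite mulrCA. Qed.

Lemma pexp_sum (J : Type) (r : seq J) (P : pred J) (F : J -> {ffun I -> V} -> R) :
  pexp (fun x => \sum_(j <- r | P j) F j x) = \sum_(j <- r | P j) pexp (F j).
Proof.
by rewrite /pexp exchange_big/=; apply: eq_bigr => x _; rewrite mulr_sumr.
Qed.

Lemma pexp_prod (f : I -> V -> R) :
  pexp (fun x => \prod_i f i (x i)) = \prod_i \sum_v mu v * f i v.
Proof.
rewrite bigA_distr_bigA/=; apply: eq_bigr => x _.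
by rewrite -big_split.
Qed.

Hypothesis mu_ge0 : forall v, 0 <= mu v.

Lemma pexp_le F G : (forall x, F x <= G x) -> pexp F <= pexp G.
Proof.
by move=> FG; apply: ler_sum => x _; rewrite ler_wpM2l// prodr_ge0.
Qed.

Hypothesis mu_sum1 : \sum_v mu v = 1.

Lemma pexp_cst c : pexp (fun=> c) = c.
Proof.
rewrite /pexp -mulr_suml -[X in X * _]/(\sum_(x : {ffun I -> V}) \prod_i mu (x i)).
by rewrite -(bigA_distr_bigA (fun _ => mu)) big1 ?mul1r.
Qed.

Definition resample (k : I) (v : V) (x : {ffun I -> V}) : {ffun I -> V} :=
  [ffun i => if i == k then v else x i].

(** Exchanging [v] with the value of [x] at [k] is an involution of pairs (v, x) that preserves the
    product weight. This is conditioning on all coordinates but [k]. *)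
Lemma pexp_resample k F :
  pexp F = pexp (fun x => \sum_v mu v * F (resample k v x)).
Proof.
have -> : pexp F = \sum_v mu v * pexp F by rewrite -mulr_suml mu_sum1 mul1r.
rewrite /pexp; under eq_bigr do rewrite mulr_sumr.
under [RHS]eq_bigr do rewrite mulr_sumr.
rewrite [RHS]exchange_big/= !pair_big/=.
rewrite (reindex (fun q : V * {ffun I -> V} => (q.2 k, resample k q.1 q.2)))/=.
  apply: eq_bigr => -[v x] _ /=.
  have -> : \prod_i mu (resample k v x i) = mu v * \prod_(i | i != k) mu (x i).
    rewrite (bigD1 k)//= ffunE eqxx; congr (_ * _).
    by apply: eq_bigr => i /negPf ik; rewrite ffunE ik.
  rewrite [in RHS](bigD1 k)//= -!mulrA; congr (_ * _).
  by rewrite mulrCA.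
exists (fun q : V * {ffun I -> V} => (q.2 k, resample k q.1 q.2)) => -[v x] _ /=;
  rewrite /resample ffunE eqxx; congr (_, _); apply/ffunP => i; rewrite !ffunE;
  by case: eqP => [->|].
Qed.

End ProductLaw.

Section SparseSigns.
Context {R : realFieldType} {I : finType}.
Variable p : R.

(** The first bit says whether the entry is sampled, the second is a fair sign, drawn even for
    unsampled entries. Keeping the pair lets one configuration carry both the centered indicator of
    the quadratic part and the sign of the linear part. *)
Definition sign_law (v : bool * bool) : R := (if v.1 then p else 1 - p) / 2.

Definition sgb (b : bool) : R := if b then 1 else -1.

Definition sparse_sign (v : bool * bool) : R := if v.1 then sgb v.2 else 0.

Lemma sum_bool_pair (f : bool * bool -> R) : \sum_v f v =
  f (true, true) + f (true, false) + f (false, true) + f (false, false).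
Proof.
rewrite (eq_bigr (fun v => f (v.1, v.2))); last by case.
rewrite -(pair_big xpredT xpredT (fun a b => f (a, b)))/=.
by rewrite !big_bool/= !addrA.
Qed.

Lemma sign_law_sum1 : \sum_v sign_law v = 1.
Proof. by rewrite sum_bool_pair /sign_law/=; field. Qed.

Hypothesis p01 : 0 <= p <= 1.

Lemma sign_law_ge0 v : 0 <= sign_law v.
Proof.
by case/andP: p01 => p0 p1; rewrite /sign_law divr_ge0//; case: ifP => //; rewrite subr_ge0.
Qed.

Lemma sgb_mul b : sgb b * sgb b = 1.
Proof. by case: b; rewrite /sgb ?mulr1// mulrNN mulr1. Qed.

Definition even_mult (T : eqType) (l : seq T) := all (fun e => ~~ odd (count_mem e l)) l.

Lemma sum_sparse_signX n : \sum_v sign_law v * sparse_sign v ^+ n =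
  if n == 0%N then 1 else if odd n then 0 else p.
Proof.
case: n => [|n] /=.
  by under eq_bigr do rewrite expr0 mulr1; exact: sign_law_sum1.
rewrite sum_bool_pair /sign_law/sparse_sign/= expr0n/= !mulr0 !addr0 expr1n mulr1 /sgb.
rewrite -signr_odd/=; case: (odd n) => /=; rewrite ?expr0 ?expr1; first by field.
by ring.
Qed.

(** By independence the product factors over distinct entries; an odd power of a sparse sign is
    centered, and a positive even power has mean [p] whatever the exponent. *)
Lemma pexp_sparse_sign (l : seq I) : pexp sign_law (fun x => \prod_(e <- l) sparse_sign (x e)) =
  (even_mult l)%:R * p ^+ size (undup l).
Proof.
transitivity (pexp sign_law (fun x : {ffun I -> bool * bool} =>
    \prod_e sparse_sign (x e) ^+ count_mem e l)).
  apply: eq_pexp => x; elim: l => [|e l IH] /=; first by rewrite big_nil big1.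
  rewrite big_cons IH (bigD1 e)//= [in RHS](bigD1 e)//= eqxx exprD expr1 -!mulrA.
  by congr (_ * (_ * _)); apply: eq_bigr => i; rewrite eq_sym => /negPf ->.
rewrite (pexp_prod _ (fun e v => sparse_sign v ^+ count_mem e l)).
under eq_bigr do rewrite sum_sparse_signX.
have [/allP ev|/allPn [e el /negPn oe]] := boolP (even_mult l); last first.
  rewrite mul0r (bigD1 e)//= oe ifN ?mul0r//.
  by rewrite -lt0n -has_count has_pred1.
rewrite mul1r (eq_bigr (fun e => if e \in undup l then p else 1)); last first.
  move=> e _; rewrite mem_undup -has_pred1 has_count.
  have := ev e; rewrite -[in X in X -> _]has_pred1 has_count lt0n.
  by case: eqP => //= _ /(_ isT) /negPf ->.
rewrite -big_mkcond/= -big_uniq ?undup_uniq//=.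
by rewrite big_const_seq count_predT iter_mulr_1.
Qed.

End SparseSigns.

(** * Even closed walks *)

Section Walks.

(** The walk a, j1, i1, j2, i2, ... alternates between row and column vertices; each edge is
    recorded as (row, column) regardless of the direction of travel. *)
Fixpoint edges (T1 T2 : Type) (a : T1) (i : seq T1) (j : seq T2) : seq (T1 * T2) :=
  match i, j with
  | i1 :: i', j1 :: j' => (a, j1) :: (i1, j1) :: edges i1 i' j'
  | _, _ => [::]
  end.

Lemma edges_map (T1 T2 U1 U2 : Type) (f : T1 -> U1) (g : T2 -> U2) a i j :
  edges (f a) (map f i) (map g j) = map (fun e => (f e.1, g e.2)) (edges a i j).
Proof. by elim: i a j => [|i1 i IH] a [|j1 j]//=; rewrite IH. Qed.

Lemma mem_edges (T1 T2 : eqType) (a : T1) (i : seq T1) (j : seq T2) e :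
  e \in edges a i j -> (e.1 \in a :: i) && (e.2 \in j).
Proof.
elim: i a j => [|i1 i IH] a [|j1 j]//=; rewrite !inE => /or3P[/eqP->|/eqP->|] /=.
- by rewrite !eqxx.
- by rewrite !eqxx orbT.
- by move=> /IH /andP[+ ->]; rewrite !inE => ->; rewrite !orbT.
Qed.

(* A connected graph with v vertices has at least v - 1 edges. *)
Lemma size_edges (T1 T2 : eqType) (a : T1) (i : seq T1) (j : seq T2) :
  size i = size j ->
  (size (undup (a :: i)) + size (undup j) <= (size (undup (edges a i j))).+1)%N.
Proof.
elim: i a j => [|i1 i IH] a [|j1 j]//= [] ij.
have := IH i1 j ij; rewrite /= !inE !xpair_eqE eqxx andbT.
set E := edges i1 i j.
(* An edge that already occurs in the rest of the walk has both endpoints there, so each new vertex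
   brings a new edge; the case analysis only counts. *)
have aE : (a, j1) \in E -> (a \in i1 :: i) && (j1 \in j) by exact: mem_edges.
have iE : (i1, j1) \in E -> (i1 \in i1 :: i) && (j1 \in j) by exact: mem_edges.
move: aE iE; rewrite !inE eqxx/=.
case: (a =P i1) => [->|] /=; case: (a \in i); case: (j1 \in j) => //=;
 case: ((a, j1) \in E) => //=; case: ((i1, j1) \in E) => //=;
 (try by move=> /(_ isT)); (try by move=> _ /(_ isT));
 case: (i1 \in i) => /=; lia.
Qed.

Lemma even_mult_map (T U : eqType) (f : T -> U) (l : seq T) :
  {in l &, injective f} -> even_mult (map f l) = even_mult l.
Proof.
move=> finj; rewrite /even_mult all_map; apply: eq_in_all => e el /=.
congr (~~ odd _); rewrite count_map; apply: eq_in_count => x xl /=.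
by apply/eqP/eqP => [/finj->|->].
Qed.

End Walks.

(** * Comparison of sums over labelled walks through their relabelling patterns *)

Section Compare.

(** The pattern of a sequence: two sequences have the same [canon] exactly when an injective
    relabelling carries one to the other. *)
Definition canon (T : eqType) (l : seq T) : seq nat := [seq index x (undup l) | x <- l].

Lemma undup_map_in (T U : eqType) (f : T -> U) (l : seq T) :
  {in l &, injective f} -> undup (map f l) = map f (undup l).
Proof.
elim: l => //= x l IH finj.
have -> : (f x \in map f l) = (x \in l).
  apply/mapP/idP => [[y yl /finj]|xl]; last by exists x.
  by rewrite !inE yl eqxx orbT => ->.
have -> : undup (map f l) = map f (undup l).
  by apply: IH => y z yl zl; apply: finj; rewrite inE ?yl ?zl orbT.
by case: ifP.
Qed.

Lemma index_undup_inj (T : eqType) (l : seq T) :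
  {in l &, injective (fun x => index x (undup l))}.
Proof.
move=> x y xl yl e.
have xl' : x \in undup l by rewrite mem_undup.
have yl' : y \in undup l by rewrite mem_undup.
by rewrite -(nth_index x xl') -(nth_index x yl') e.
Qed.

Lemma canon_map (T U : eqType) (f : T -> U) (l : seq T) :
  {in l &, injective f} -> canon (map f l) = canon l.
Proof.
move=> finj; rewrite /canon undup_map_in// -map_comp; apply/eq_in_map => x xl /=.
have : {subset undup l <= l} by move=> y; rewrite mem_undup.
elim: (undup l) => //= y s IH sl.
have yl : y \in l by apply: sl; rewrite inE eqxx.
rewrite IH; last by move=> z zs; apply: sl; rewrite inE zs orbT.
by congr (if _ then _ else _); apply/eqP/eqP => [/finj->|->].
Qed.

Lemma canonK (T : eqType) (l : seq T) : canon (canon l) = canon l.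
Proof. exact/canon_map/index_undup_inj. Qed.

Lemma size_undup_canon (T : eqType) (l : seq T) : size (undup (canon l)) = size (undup l).
Proof. by rewrite undup_map_in ?size_map//; exact: index_undup_inj. Qed.

Lemma canonE (T : eqType) (x0 : T) (l : seq T) : l = map (nth x0 (undup l)) (canon l).
Proof.
rewrite -map_comp -[LHS]map_id; apply/eq_in_map => x xl /=.
by rewrite nth_index// mem_undup.
Qed.

Lemma undup_canon_lt (T : eqType) (l : seq T) :
  undup (canon l) = iota 0 (size (undup l)).
Proof.
rewrite undup_map_in; last exact: index_undup_inj.
elim: (undup l) (undup_uniq l) => //= x s IH /andP[xs us].
rewrite eqxx; congr (_ :: _); rewrite (iotaDl 1 0) -IH// -map_comp.
by apply/eq_in_map => y ys /=; case: eqP => // xy; rewrite xy ys in xs.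
Qed.

Lemma card_canon_le m k (s : seq nat) :
  (#|[set l : k.-tuple 'I_m.+1 | canon l == s]| <= m.+1 ^ size (undup s))%N.
Proof.
set v := size (undup s).
pose f (u : v.-tuple 'I_m.+1) : k.-tuple 'I_m.+1 :=
  [tuple nth ord0 u (nth 0%N s i) | i < k].
rewrite -[X in (_ <= X ^ _)%N]card_ord -card_tuple -cardsT.
apply: leq_trans (leq_imset_card f _).
apply: subset_leq_card; apply/fintype.subsetP => l; rewrite inE => /eqP ls.
have sv : size (undup l) == v by rewrite /v -ls size_undup_canon.
apply/imsetP; exists (Tuple sv) => //; apply: eq_from_tnth => i.
rewrite tnth_mktuple/= -ls (tnth_nth ord0) {1}(canonE ord0 l).
rewrite (nth_map 0%N)// size_map size_tuple//.
Qed.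

Lemma card_canon_ge (T : eqType) r k (l0 : k.-tuple T) :
  (r.+1 ^_ size (undup l0) <=
   #|[set l : k.-tuple 'I_r.+1 | canon l == canon l0]|)%N.
Proof.
set v := size (undup l0); pose s := canon l0.
pose f (u : v.-tuple 'I_r.+1) : k.-tuple 'I_r.+1 :=
  [tuple nth ord0 u (nth 0%N s i) | i < k].
have sk : size s = k by rewrite size_map size_tuple.
have fE u : tval (f u) = map (nth ord0 u) s.
  apply: (@eq_from_nth _ ord0); rewrite ?size_tuple ?size_map ?sk// => i ik.
  by rewrite -(tnth_nth _ _ (Ordinal ik)) tnth_mktuple (nth_map 0%N)// sk.
have us : undup s = iota 0 v by exact: undup_canon_lt.
have sv j : (j \in s) = (j < v)%N by rewrite -mem_undup us mem_iota.
have -> : (r.+1 ^_ v = #|[set u : v.-tuple 'I_r.+1 | all xpredT u & uniq u]|)%N.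
  by rewrite card_uniq_tuples card_ord.
have finj : {in [set u : v.-tuple 'I_r.+1 | all xpredT u & uniq u] &, injective f}.
  move=> u u' _ _ /(congr1 (@tval _ _)); rewrite !fE => /eq_in_map uu'.
  apply: eq_from_tnth => j; rewrite !(tnth_nth ord0); apply: uu'.
  by rewrite sv.
rewrite -(card_in_imset finj); apply: subset_leq_card.
apply/fintype.subsetP => _ /imsetP[u + ->]; rewrite !inE => /andP[_ uu].
rewrite fE canon_map ?canonK//.
move=> i j; rewrite !sv => iv jv /eqP; rewrite nth_uniq ?size_tuple//.
by move/eqP.
Qed.

Lemma leq_exp_ffact r k v : (v <= k)%N -> ((r - k) ^ v <= r ^_ v)%N.
Proof.
move=> vk; rewrite ffact_prod -[X in (_ ^ X)%N]card_ord -prod_nat_const.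
by apply: leq_prod => i _; apply: leq_sub2l; apply: ltnW; apply: leq_trans vk.
Qed.

(** [F] depends only on the pattern. A pattern with v distinct values has at most (m+1)^v
    realizations among the small labels and at least the falling factorial of r+1, hence (r+1-k)^v,
    among the others; the hypothesis on [c] compares the two counts factor by factor. *)
Lemma sum_relabel_le (R : realFieldType) (F : seq nat -> R) (c : R) m r k :
  (forall l, 0 <= F l) ->
  (forall f l, {in l &, injective f} -> F (map f l) = F l) ->
  0 <= c -> c * m.+1%:R <= (r.+1 - k)%:R -> (k <= r)%N ->
  \sum_(l : k.-tuple 'I_m.+1) c ^+ size (undup l) * F (map val l) <=
  \sum_(l : k.-tuple 'I_r.+1) F (map val l).
Proof.
move=> F0 Finv c0 cmr kr.
have FE n (l : seq 'I_n) : F (map val l) = F (canon l).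
  rewrite -(Finv (index^~ (undup (map val l)))); last exact: index_undup_inj.
  by rewrite -[map _ _]/(canon (map val l)) canon_map// => x y _ _ /val_inj.
pose N (s : seq nat) := #|[set l : k.-tuple 'I_r.+1 | canon l == s]|.
have N1 (l : k.-tuple 'I_m.+1) : (r.+1 ^_ size (undup l) <= N (canon l))%N.
  exact: card_canon_ge.
have vk (l : k.-tuple 'I_m.+1) : (size (undup l) <= k)%N.
  by rewrite -[X in (_ <= X)%N](size_tuple l) size_undup.
have N0 (l : k.-tuple 'I_m.+1) : 0 < (N (canon l))%:R :> R.
  rewrite ltr0n; apply: leq_trans (N1 l); rewrite ffact_gt0.
  by apply: leq_trans (vk l) _; apply: leq_trans kr _.
(* Double counting: the term of each [l] is spread evenly over the [N (canon l)] sequences [l'] of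
   the same pattern, and the order of summation is then exchanged. *)
apply: (@le_trans _ _ (\sum_(l : k.-tuple 'I_m.+1)
   \sum_(l' : k.-tuple 'I_r.+1 | canon l' == canon l)
     c ^+ size (undup l) * (F (map val l) / (N (canon l))%:R))).
  apply: ler_sum => l _; rewrite sumr_const -[X in _ *+ X]/(#|_|).
  rewrite (_ : #|_| = N (canon l)); last by apply: eq_card => l'; rewrite inE.
  by rewrite -[_ *+ _]mulr_natr -!mulrA mulVf ?mulr1// gt_eqF.
rewrite (exchange_big_dep xpredT)//=; apply: ler_sum => l' _.
set w := size (undup l').
have wk : (w <= k)%N by rewrite -[X in (_ <= X)%N](size_tuple l') size_undup.
have N1' : (r.+1 ^_ w <= N (canon l'))%N.
  exact: card_canon_ge.
have N0' : 0 < (N (canon l'))%:R :> R.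
  by rewrite ltr0n; apply: leq_trans N1'; rewrite ffact_gt0 (leq_trans wk)// (leq_trans kr).
rewrite (eq_bigr (fun _ => c ^+ w * (F (map val l') / (N (canon l'))%:R))); last first.
  move=> l /eqP ll'; rewrite !FE ll'; congr (c ^+ _ * _).
  by rewrite /w -(size_undup_canon l') ll' size_undup_canon.
rewrite sumr_const -[X in _ *+ X]/(#|_|).
rewrite (_ : #|_| = #|[set l : k.-tuple 'I_m.+1 | canon l == canon l']|); last first.
  by apply: eq_card => l; rewrite inE eq_sym.
rewrite -[_ *+ _]mulr_natr.
set Q : R := #|_|%:R; have -> : c ^+ w * (F (map val l') / (N (canon l'))%:R) * Q =
  F (map val l') * (c ^+ w * Q) / (N (canon l'))%:R by ring.
rewrite ler_pdivrMr// ler_wpM2l// {}/Q.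
apply: (@le_trans _ _ (c ^+ w * (m.+1 ^ w)%:R)).
  rewrite ler_wpM2l ?exprn_ge0// ler_nat.
  by have := card_canon_le m k (canon l'); rewrite size_undup_canon.
apply: (@le_trans _ _ ((r.+1 - k) ^ w)%:R); last first.
  by rewrite ler_nat; apply: leq_trans N1'; exact: leq_exp_ffact.
by rewrite !natrX -exprMn lerXn2r// nnegrE ?mulr_ge0 ?ler0n.
Qed.

End Compare.

(** * Trace moments as weighted counts of closed even walks *)

Section TracePower.
Context {R : realFieldType}.

Lemma sum_tuple0 (T : finType) (F : 0.-tuple T -> R) : \sum_l F l = F [tuple].
Proof. by rewrite (big_pred1 [tuple]) // => l /=; apply/esym/eqP; exact: tuple0. Qed.

Lemma sum_tupleS (T : finType) q (F : q.+1.-tuple T -> R) :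
  \sum_l F l = \sum_x \sum_(l : q.-tuple T) F [tuple of x :: l].
Proof.
rewrite pair_big/= (reindex (fun z : T * q.-tuple T => [tuple of z.1 :: z.2]))//=.
exists (fun l => (thead l, [tuple of behead l])) => [[x l] _|l _] /=.
  by congr (_, _); rewrite ?theadE//; apply: val_inj.
by rewrite -tuple_eta.
Qed.

Lemma walk_expansion m1 m2 (X : 'M[R]_(m1, m2)) q a c :
  ((X *m X^T) ^+ q) a c =
  \sum_(i : q.-tuple 'I_m1) \sum_(j : q.-tuple 'I_m2)
    (last a i == c)%:R * \prod_(e <- edges a i j) X e.1 e.2.
Proof.
elim: q a => [|q IH] a.
  by rewrite expr0 !sum_tuple0 big_nil mulr1 mxE.
rewrite exprS [LHS]mxE sum_tupleS; apply: eq_bigr => i1 _.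
under eq_bigr do rewrite sum_tupleS; rewrite exchange_big/=.
rewrite mxE mulr_suml; apply: eq_bigr => j1 _.
rewrite IH mulr_sumr; apply: eq_bigr => i _.
rewrite mulr_sumr; apply: eq_bigr => j _.
by rewrite !big_cons !mxE /=; ring.
Qed.

Definition trpow m1 m2 (X : 'M[R]_(m1, m2)) q := \tr ((X *m X^T) ^+ q).

Definition sign_mx m1 m2 (x : {ffun 'I_m1 * 'I_m2 -> bool * bool}) : 'M[R]_(m1, m2) :=
  \matrix_(i, j) sparse_sign (x (i, j)).

(** Labels are natural numbers so that the same predicate serves graphs of different sizes and is
    visibly invariant under relabelling. The row labels [l] include the starting vertex, which a
    closed walk repeats at its end. *)
Definition closed_even (j l : seq nat) : bool :=
  if l is a :: i then (last a i == a) && even_mult (edges a i j) else false.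

Definition walk_edges (T1 T2 : eqType) (l : seq T1) (j : seq T2) : seq (T1 * T2) :=
  if l is a :: i then edges a i j else [::].

Lemma pexp_trpow (p : R) m1 m2 q :
  pexp (sign_law p) (fun x => trpow (@sign_mx m1 m2 x) q) =
  \sum_(l : q.+1.-tuple 'I_m1) \sum_(j : q.-tuple 'I_m2)
    (closed_even (map val j) (map val l))%:R * p ^+ size (undup (walk_edges l j)).
Proof.
rewrite sum_tupleS /trpow /mxtrace pexp_sum; apply: eq_bigr => a _.
transitivity (pexp (sign_law p) (fun x => \sum_(i : q.-tuple 'I_m1) \sum_(j : q.-tuple 'I_m2)
    (last a i == a)%:R * \prod_(e <- edges a i j) sparse_sign (x e))).
  apply: eq_pexp => x; rewrite walk_expansion; apply: eq_bigr => i _.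
  apply: eq_bigr => j _; congr (_ * _); apply: eq_bigr => -[e1 e2] _.
  by rewrite mxE.
rewrite pexp_sum; apply: eq_bigr => i _; rewrite pexp_sum; apply: eq_bigr => j _.
rewrite pexpZ pexp_sparse_sign mulrA -natrM mulnb /= last_map edges_map even_mult_map; last first.
  by move=> [x1 x2] [y1 y2] _ _ [/val_inj -> /val_inj ->].
by [].
Qed.

Lemma closed_even_inv1 f j l : {in l &, injective f} ->
  closed_even j (map f l) = closed_even j l.
Proof.
case: l => //= a i finj; congr (_ && _).
  rewrite last_map; apply/eqP/eqP => [/finj->|->]//; last by rewrite inE eqxx.
  by rewrite mem_last.
rewrite -{1}(map_id j) edges_map even_mult_map// => -[x1 x2] [y1 y2].
move=> /mem_edges/andP[x1i _] /mem_edges/andP[y1i _] [/finj + ->].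
by move=> ->.
Qed.

Lemma closed_even_inv2 f j l : {in j &, injective f} ->
  closed_even (map f j) l = closed_even j l.
Proof.
case: l => //= a i finj; congr (_ && _).
rewrite -{1}(map_id i) -[a in LHS]/(id a) edges_map even_mult_map// => -[x1 x2] [y1 y2].
move=> /mem_edges/andP[_ x2i] /mem_edges/andP[_ y2i] [-> /finj].
by move=> ->.
Qed.

(* A closed even walk with v vertices uses at least v - 1 edges, so each of the
   v vertices costs at most a factor p N (up to 1/p); in a complete bipartite
   graph on r + r vertices, r >= p N + q + 1, each new vertex has at least p N
   possible positions. *)
Lemma pexp_trpow_compare (p : R) m1 m2 r q :
  0 <= p <= 1 -> (q < r)%N ->
  p * m1.+1%:R <= (r.+1 - q.+1)%:R -> p * m2.+1%:R <= (r.+1 - q.+1)%:R ->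
  p * pexp (sign_law p) (fun x => trpow (@sign_mx m1.+1 m2.+1 x) q) <=
  pexp (sign_law 1) (fun x => trpow (@sign_mx r.+1 r.+1 x) q).
Proof.
move=> /andP[p0 p1] qr pm1 pm2; rewrite !pexp_trpow.
apply: (@le_trans _ _ (\sum_(l : q.+1.-tuple 'I_m1.+1) p ^+ size (undup l) *
   \sum_(j : q.-tuple 'I_m2.+1) p ^+ size (undup j) *
    (closed_even (map val j) (map val l))%:R)).
  rewrite mulr_sumr; apply: ler_sum => l _; rewrite !mulr_sumr; apply: ler_sum => j _.
  rewrite [leRHS]mulrA -exprD mulrCA -exprS mulrC ler_wpM2r ?ler0n// ler_wiXn2l//.
  case: (tupleP l) => a i /=; apply: size_edges; by rewrite !size_tuple.
(* The row labels are moved to the comparison graph first, with the columns summed inside [F]; the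
   columns follow with the rows fixed. *)
apply: (@le_trans _ _ (\sum_(l : q.+1.-tuple 'I_r.+1)
   \sum_(j : q.-tuple 'I_m2.+1) p ^+ size (undup j) *
    (closed_even (map val j) (map val l))%:R)).
  apply: (sum_relabel_le (F := fun l => \sum_(j : q.-tuple 'I_m2.+1) p ^+ size (undup j) *
    (closed_even (map val j) l)%:R)) => //.
    by move=> l; apply: sumr_ge0 => j _; rewrite mulr_ge0 ?exprn_ge0.
  by move=> f l finj; apply: eq_bigr => j _; rewrite closed_even_inv1.
apply: ler_sum => l _.
under [leRHS]eq_bigr do rewrite expr1n mulr1.
apply: (sum_relabel_le (F := fun j => (closed_even j (map val l))%:R)) => //.
- by move=> f j finj; rewrite closed_even_inv2.
- apply: le_trans pm2 _; rewrite ler_nat; lia.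
- exact: ltnW.
Qed.

End TracePower.

(** * Sub-Gaussian moments and nets *)

Section SubGaussian.
Context {R : realType}.

(* (1 + c + 2c^2) (1 - c/2)^2 = 1 + c^2 (1 - c) (5/4 - c/2) *)
Lemma expR_le_quad (c : R) : `|c| <= 1 -> expR c <= 1 + c + 2 * c ^+ 2.
Proof.
rewrite ler_norml => /andP[c1 c2].
have h : 1 - c / 2 <= expR (- (c / 2)) by exact: expR_ge1Dx.
have h0 : 0 < 1 - c / 2 by lra.
have -> : expR c = (expR (- (c / 2)) ^+ 2)^-1.
  by rewrite -expRM_natl -expRN; congr expR; field.
rewrite -[leLHS]mul1r ler_pdivrMr ?exprn_gt0 ?expR_gt0//.
apply: (@le_trans _ _ ((1 + c + 2 * c ^+ 2) * (1 - c / 2) ^+ 2)).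
  have : 0 <= c ^+ 2 * ((1 - c) * (5 / 4 - c / 2)).
    by apply: mulr_ge0; [exact: sqr_ge0|apply: mulr_ge0; lra].
  rewrite (_ : (1 + c + 2 * c ^+ 2) * (1 - c / 2) ^+ 2 =
    1 + c ^+ 2 * ((1 - c) * (5 / 4 - c / 2))); last by field.
  by lra.
rewrite ler_wpM2l//; last by rewrite lerXn2r// nnegrE ltW// expR_gt0.
rewrite (_ : 1 + c + 2 * c ^+ 2 = (1 + c / 2) ^+ 2 + 7 / 4 * c ^+ 2); last by field.
by apply: addr_ge0; [exact: sqr_ge0|apply: mulr_ge0; [lra|exact: sqr_ge0]].
Qed.

Lemma cosh_le (c : R) : (expR c + expR (- c)) / 2 <= expR (2 * c ^+ 2).
Proof.
have [c1|c1] := lerP `|c| 1.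
  have := expR_le_quad c1; have : `|- c| <= 1 by rewrite normrN.
  move=> /expR_le_quad; rewrite sqrrN => h1 h2.
  by apply: (le_trans _ (expR_ge1Dx _)); lra.
have c2 : `|c| <= 2 * c ^+ 2.
  by rewrite -[c ^+ 2]real_normK ?num_real//; nra.
have h1 : expR c <= expR (2 * c ^+ 2).
  by rewrite ler_expR (le_trans (ler_norm _)).
have h2 : expR (- c) <= expR (2 * c ^+ 2).
  by rewrite ler_expR (le_trans (ler_norm _))// normrN.
lra.
Qed.

Context {I : finType}.
Variable p : R.
Hypothesis p01 : 0 <= p <= 1.

Let mu0 := sign_law_ge0 p01.

(** Each factor is a mixture of 1 and a hyperbolic cosine, both at most [expR (2 * (c * a e) ^+ 2)],
    so the bound is uniform in [p]. *)
Lemma pexp_expR (a : I -> R) : \sum_e a e ^+ 2 <= 1 -> forall c,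
  pexp (sign_law p) (fun x : {ffun I -> bool * bool} => expR (c * \sum_e a e * sparse_sign (x e)))
  <= expR (2 * c ^+ 2).
Proof.
move=> a1 c.
rewrite (_ : pexp _ _ = \prod_e \sum_v sign_law p v * expR (c * (a e * sparse_sign v))); last first.
  rewrite -pexp_prod; apply: eq_pexp => x; rewrite mulr_sumr.
  by rewrite expR_sum.
apply: (@le_trans _ _ (\prod_e expR (2 * (c * a e) ^+ 2))).
  apply: ler_prod => e _; apply/andP; split.
    by apply: sumr_ge0 => v _; rewrite mulr_ge0 ?expR_ge0.
  rewrite sum_bool_pair /sign_law/sparse_sign/sgb/= !mulr0 expR0 !mulr1 mulrN1 mulrN -mulrA.
  have := cosh_le (c * a e); have : 1 <= expR (2 * (c * a e) ^+ 2).
    by rewrite -expR0 ler_expR mulr_ge0 ?sqr_ge0.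
  case/andP: p01 => p0 p1.
  by nra.
rewrite -expR_sum ler_expR -mulr_sumr ler_wpM2l//.
under eq_bigr do rewrite exprMn; rewrite -mulr_sumr ler_piMr ?sqr_ge0//.
Qed.

Lemma exprn_le_expR (x : R) n : 0 <= x -> (0 < n)%N ->
  x ^+ n <= n%:R ^+ n * expR (x - n%:R).
Proof.
move=> x0 n0.
have n0' : 0 < n%:R :> R by rewrite ltr0n.
have -> : expR (x - n%:R) = expR (x / n%:R - 1) ^+ n.
  by rewrite -expRM_natl; congr expR; field; rewrite gt_eqF.
rewrite -exprMn lerXn2r ?nnegrE ?mulr_ge0 ?expR_ge0 ?ler0n//.
rewrite -ler_pdivrMl// mulrC.
by apply: (le_trans _ (expR_ge1Dx _)); lra.
Qed.

Lemma pexp_moment (a : I -> R) q : \sum_e a e ^+ 2 <= 1 -> (0 < q)%N ->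
  pexp (sign_law p) (fun x : {ffun I -> bool * bool} => (\sum_e a e * sparse_sign (x e)) ^+ (2 * q))
  <= 2 * (4 * q%:R) ^+ q.
Proof.
move=> a1 q0.
have q0' : 0 < q%:R :> R by rewrite ltr0n.
(* With c^2 = q, the factor exp(-2q) from bounding a power by an exponential cancels exp(2 c^2) from
   the generating function; what is left is (2q)^(2q) / q^q = (4q)^q. *)
pose c : R := Num.sqrt q%:R.
have c0 : 0 < c by rewrite sqrtr_gt0.
have c2 : c ^+ 2 = q%:R by rewrite sqr_sqrtr// ltW.
pose K : R := (4 * q%:R) ^+ q * expR (- (2 * q)%:R).
have K0 : 0 <= K by rewrite mulr_ge0 ?expR_ge0// exprn_ge0// mulr_ge0// ltW.
have pw (s : R) : s ^+ (2 * q) <= K * (expR (c * s) + expR (- c * s)).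
  have -> : s ^+ (2 * q) = `|s| ^+ (2 * q).
    by rewrite !exprM real_normK ?num_real.
  have h : expR (c * `|s|) <= expR (c * s) + expR (- c * s).
    have := expR_ge0 (c * s); have := expR_ge0 (- c * s).
    by case: (ger0P s) => _; rewrite ?mulrN -?mulNr; lra.
  have : (c * `|s|) ^+ (2 * q) <= (2 * q)%:R ^+ (2 * q) * expR (c * `|s| - (2 * q)%:R).
    by apply: exprn_le_expR; rewrite ?mulr_ge0 ?muln_gt0// ltW.
  rewrite exprMn (exprM c) c2 expRD mulrA.
  have -> : (2 * q)%:R ^+ (2 * q) = q%:R ^+ q * (4 * q%:R) ^+ q :> R.
    rewrite -exprMn exprM; congr (_ ^+ _); rewrite natrM; ring.
  move=> h1; have : `|s| ^+ (2 * q) <= K * expR (c * `|s|).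
    rewrite -(ler_pM2l (exprn_gt0 q q0')); apply: le_trans h1 _.
    by rewrite le_eqVlt; apply/orP; left; apply/eqP; rewrite /K; ring.
  by move=> h2; apply: le_trans h2 _; rewrite ler_wpM2l.
apply: (le_trans (pexp_le mu0 (fun x => pw _))).
rewrite pexpZ pexpD.
have h1 := pexp_expR a1 c; have h2 := pexp_expR a1 (- c).
rewrite sqrrN c2 in h1 h2.
apply: (@le_trans _ _ (K * (2 * expR (2 * q%:R)))).
  by rewrite ler_wpM2l//; lra.
rewrite /K mulrCA -[_ ^+ q * _ * _]mulrA -expRD natrM.
by rewrite addNr expR0 mulr1.
Qed.

End SubGaussian.

(** * Spectral bound for sparse sign matrices *)

Section Quadratic.
Context {R : realFieldType}.

(** Cauchy-Schwarz by Lagrange's identity: twice the gap is a double sum of squares. *)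
Lemma sqr_sum_le (I : finType) (a b : I -> R) :
  (\sum_i a i * b i) ^+ 2 <= (\sum_i a i ^+ 2) * (\sum_i b i ^+ 2).
Proof.
have : 0 <= \sum_i \sum_j (a i * b j - a j * b i) ^+ 2.
  by apply: sumr_ge0 => i _; apply: sumr_ge0 => j _; exact: sqr_ge0.
have -> : \sum_i \sum_j (a i * b j - a j * b i) ^+ 2 =
   2 * ((\sum_i a i ^+ 2) * (\sum_i b i ^+ 2) - (\sum_i a i * b i) ^+ 2).
  under eq_bigr => i _.
    under eq_bigr => j _.
      rewrite (_ : _ ^+ 2 = a i ^+ 2 * b j ^+ 2 + a j ^+ 2 * b i ^+ 2 -
        2 * ((a i * b i) * (a j * b j))); last by ring.
      over.
    rewrite sumrB big_split/= -mulr_sumr -mulr_suml -mulr_sumr -mulr_sumr.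
    over.
  rewrite sumrB big_split/= -!mulr_suml -!mulr_sumr -mulr_suml. ring.
lra.
Qed.

Definition sqnorm n (u : 'rV[R]_n) : R := \sum_i u 0 i ^+ 2.

Definition bform m n (A : 'M[R]_(m, n)) (u : 'rV_m) (v : 'rV_n) : R :=
  (u *m A *m v^T) 0 0.

Lemma sqnorm_ge0 n (u : 'rV[R]_n) : 0 <= sqnorm u.
Proof. by apply: sumr_ge0 => i _; exact: sqr_ge0. Qed.

Lemma sqnormE n (u : 'rV[R]_n) : sqnorm u = (u *m u^T) 0 0.
Proof. by rewrite mxE; apply: eq_bigr => i _; rewrite mxE expr2. Qed.

Lemma sqnormZ n c (u : 'rV[R]_n) : sqnorm (c *: u) = c ^+ 2 * sqnorm u.
Proof. by rewrite mulr_sumr; apply: eq_bigr => i _; rewrite mxE exprMn. Qed.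

Lemma bformE m n (A : 'M[R]_(m, n)) (u : 'rV_m) (v : 'rV_n) :
  bform A u v = \sum_(e : 'I_m * 'I_n) (u 0 e.1 * v 0 e.2) * A e.1 e.2.
Proof.
rewrite /bform mxE -(pair_big xpredT xpredT (fun i j => u 0 i * v 0 j * A i j))/=.
rewrite exchange_big/=; apply: eq_bigr => j _; rewrite !mxE mulr_suml.
by apply: eq_bigr => i _; ring.
Qed.

Lemma bform_sqr_le m n (A : 'M[R]_(m, n)) u v : bform A u v ^+ 2 <= sqnorm (u *m A) * sqnorm v.
Proof.
rewrite /bform mxE; under eq_bigr do rewrite [v^T _ _]mxE.
exact: sqr_sum_le.
Qed.

Lemma bformT m n (A : 'M[R]_(m, n)) u v : bform A^T v u = bform A u v.
Proof. by rewrite /bform -[in LHS](trmxK v) -trmx_mul -[in LHS](trmxK u) -trmx_mul mxE mulmxA trmxK. Qed.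

Lemma sqnorm_mulmx m n (A : 'M[R]_(m, n)) u : sqnorm (u *m A) = bform (A *m A^T) u u.
Proof. by rewrite sqnormE /bform trmx_mul !mulmxA. Qed.

Lemma sqnorm_mulmx_le_tr m n (A : 'M[R]_(m, n)) u : sqnorm (u *m A) <= sqnorm u * \tr (A *m A^T).
Proof.
have -> : \tr (A *m A^T) = \sum_j \sum_i A i j ^+ 2.
  rewrite exchange_big/=; apply: eq_bigr => i _; rewrite mxE.
  by apply: eq_bigr => j _; rewrite mxE expr2.
rewrite /sqnorm mulr_sumr; apply: ler_sum => j _; rewrite mxE.
exact: sqr_sum_le.
Qed.

Lemma trmxX n (S : 'M[R]_n) k : (S ^+ k)^T = S^T ^+ k.
Proof. by elim: k => [|k IH]; rewrite ?expr0 ?trmx1// exprS exprSr trmx_mul IH. Qed.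

Lemma bform_pow m n (X : 'M[R]_(m, n)) t u :
  bform (X *m X^T) u u ^+ (2 ^ t) <= sqnorm u ^+ (2 ^ t) * trpow X (2 ^ t).
Proof.
rewrite /trpow; set S := X *m X^T; have ST : S^T = S by rewrite /S trmx_mul trmxK.
have S0 k : bform (S ^+ (2 * k)) u u = sqnorm (u *m S ^+ k).
  by rewrite sqnorm_mulmx trmxX ST mulmxE -exprD addnn mul2n.
have qf0 k : 0 <= bform (S ^+ (2 ^ k)) u u.
  by case: k => [|k]; rewrite ?expr1 -?sqnorm_mulmx ?expnS ?S0 sqnorm_ge0.
(* Each use of Cauchy-Schwarz doubles the exponent of [S], which is why moment orders are powers of
   two. The predecessor in the exponent keeps back one factor [sqnorm u] for the final bound by the
   trace. *)
have h : bform S u u ^+ (2 ^ t) <= sqnorm u ^+ (2 ^ t).-1 * bform (S ^+ (2 ^ t)) u u.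
  elim: t => [|t IH]; first by rewrite !expr1 expr0 mul1r.
  rewrite expnSr exprM.
  have : (bform S u u ^+ (2 ^ t)) ^+ 2 <= (sqnorm u ^+ (2 ^ t).-1 * bform (S ^+ (2 ^ t)) u u) ^+ 2.
    rewrite lerXn2r// nnegrE; last by rewrite mulr_ge0 ?exprn_ge0 ?sqnorm_ge0.
    by rewrite exprn_ge0// -sqnorm_mulmx sqnorm_ge0.
  move/le_trans; apply.
  rewrite exprMn -exprM (_ : bform (S ^+ (2 ^ t * 2)) u u = sqnorm (u *m S ^+ (2 ^ t))); last by rewrite mulnC S0.
  have -> : ((2 ^ t) * 2).-1 = ((2 ^ t).-1 * 2).+1.
    by have := expn_gt0 2 t; case: (2 ^ t)%N => //= k _; lia.
  rewrite [X in _ <= X * _]exprSr -mulrA ler_wpM2l ?exprn_ge0 ?sqnorm_ge0// [leRHS]mulrC.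
  exact: bform_sqr_le.
apply: le_trans h _.
have -> : (2 ^ t = (2 ^ t).-1.+1)%N by rewrite prednK// expn_gt0.
rewrite [X in _ <= X * _]exprSr prednK ?expn_gt0// -mulrA.
rewrite ler_wpM2l ?exprn_ge0 ?sqnorm_ge0//.
case: t => [|t]; first by rewrite !expr1 -sqnorm_mulmx; exact: sqnorm_mulmx_le_tr.
rewrite expnS S0; apply: le_trans (sqnorm_mulmx_le_tr _ _) _.
by rewrite trmxX ST mulmxE -exprD addnn mul2n.
Qed.

(* Since X X^T is symmetric, Cauchy-Schwarz squares the quadratic form as
   often as wanted; the trace then bounds the last form. *)
Lemma bform_trpow m n (X : 'M[R]_(m, n)) t u v :
  bform X u v ^+ (2 * 2 ^ t) <= (sqnorm u * sqnorm v) ^+ (2 ^ t) * trpow X (2 ^ t).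
Proof.
rewrite exprM; apply: (@le_trans _ _ ((sqnorm (u *m X) * sqnorm v) ^+ (2 ^ t))).
  by apply: lerXn2r; rewrite ?nnegrE ?sqr_ge0 ?bform_sqr_le// mulr_ge0 ?sqnorm_ge0.
rewrite !exprMn mulrAC ler_wpM2r ?exprn_ge0 ?sqnorm_ge0//.
rewrite sqnorm_mulmx; exact: bform_pow.
Qed.

End Quadratic.

(** * Trace duality for low-rank matrices *)

Section LowRank.
Context {R : realType}.

(* Gram-Schmidt without normalization; rows of [Q] may vanish. *)
Lemma gram_schmidt r n (G : 'M[R]_(r, n)) :
  exists (W : 'M[R]_r) (Q : 'M[R]_(r, n)), G = W *m Q /\ is_diag_mx (Q *m Q^T).
Proof.
elim: r G => [|r IH] G.
  exists 0, 0; split; first by apply/matrixP => -[].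
  by apply/is_diag_mxP => -[].
pose g := @usubmx _ 1 r n G; have [W [Q [GE QD]]] := IH (@dsubmx _ 1 r n G).
pose c : 'rV_r := \row_k ((g *m Q^T) 0 k / (Q *m Q^T) k k).
have cD : c *m (Q *m Q^T) = g *m Q^T.
  apply/rowP => k; rewrite mxE (bigD1 k)//= big1 ?addr0; last first.
    by move=> l lk; rewrite (is_diag_mxP QD _ _ lk) mulr0.
  (* If row [k] of [Q] vanishes, both sides are 0, whatever value the division by zero has in
     [c]. *)
  rewrite mxE; have [Qk|Qk] := eqVneq ((Q *m Q^T) k k) 0; last by rewrite divfK.
  rewrite Qk mulr0 mxE big1// => j _; rewrite [Q^T _ _]mxE.
  suff /eqP -> : Q k j == 0 by rewrite mulr0.
  rewrite -sqrf_eq0; move: Qk; rewrite mxE => /eqP; rewrite psumr_eq0.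
    by move=> /allP /(_ j); rewrite mem_index_enum mxE -expr2 => /(_ isT).
  by move=> i _; rewrite mxE -expr2 sqr_ge0.
exists (@block_mx _ 1 r 1 r 1%:M c 0 W), (@col_mx _ 1 r n (g - c *m Q) Q).
rewrite (@mul_block_col _ 1 r 1 r) mul1mx mul0mx add0r subrK -GE vsubmxK; split => //.
have o : (g - c *m Q) *m Q^T = 0 by rewrite mulmxBl -mulmxA cD subrr.
rewrite (@tr_col_mx _ 1 r) (@mul_col_row _ 1 r _ 1 r) o.
rewrite -[Q *m (_ - _)^T]trmxK trmx_mul trmxK o trmx0.
rewrite (@is_diag_block_mx _ 1 r 1 r)// !eqxx QD !andbT /=.
by apply/is_diag_mxP => i j; rewrite !ord1.
Qed.

Definition mxdot m n (X H : 'M[R]_(m, n)) : R :=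
  \sum_(e : 'I_m * 'I_n) X e.1 e.2 * H e.1 e.2.

Lemma frob_normE m n (H : 'M[R]_(m, n)) : frob_norm H ^+ 2 = mxdot H H.
Proof.
rewrite sqr_sqrtr; last by apply: sumr_ge0 => i _; apply: sumr_ge0 => j _; exact: sqr_ge0.
rewrite pair_big/=; apply: eq_bigr => e _; exact: expr2.
Qed.

Lemma frob_norm_ge0 m n (H : 'M[R]_(m, n)) : 0 <= frob_norm H.
Proof. exact: sqrtr_ge0. Qed.

(** [H] is written as a sum of [\rank H] dyads with orthogonal right factors. Orthogonality makes
    |H|_F^2 the sum of the squared norms of the dyads, so Cauchy-Schwarz over the dyads costs only
    the square root of the rank; no singular value decomposition is involved. *)
Lemma mxdot_low_rank m n (X H : 'M[R]_(m, n)) (theta : R) : 0 <= theta ->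
  (forall u v, bform X u v <= theta * Num.sqrt (sqnorm u * sqnorm v)) ->
  mxdot X H <= theta * Num.sqrt (\rank H)%:R * frob_norm H.
Proof.
move=> t0 Xt; have [W [Q [GE /is_diag_mxP QD]]] := gram_schmidt (row_base H).
have HE : H = (col_base H *m W) *m Q by rewrite -mulmxA -GE mulmx_base.
set A := col_base H *m W in HE; set r := \rank H in W Q GE QD A HE *.
pose a k := (col k A)^T; pose b k := row k Q.
have HeE i j : H i j = \sum_k a k 0 i * b k 0 j.
  by rewrite HE mxE; apply: eq_bigr => k _; rewrite !mxE.
have h1 : mxdot X H = \sum_k bform X (a k) (b k).
  under [RHS]eq_bigr do rewrite bformE; rewrite exchange_big/=.
  apply: eq_bigr => e _; rewrite HeE mulr_sumr; apply: eq_bigr => k _.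
  by rewrite mulrC.
have h2 : mxdot H H = \sum_k sqnorm (a k) * sqnorm (b k).
  rewrite /mxdot -(pair_big xpredT xpredT (fun i j => H i j * H i j))/=.
  rewrite /sqnorm; under [RHS]eq_bigr do rewrite mulr_suml; rewrite [RHS]exchange_big/=.
  apply: eq_bigr => i _.
  transitivity (\sum_k \sum_l a k 0 i * a l 0 i * (Q *m Q^T) k l).
    under eq_bigr do rewrite HeE mulr_suml; rewrite exchange_big/=.
    apply: eq_bigr => k _; under eq_bigr do rewrite mulr_sumr.
    rewrite exchange_big/=; apply: eq_bigr => l _; rewrite [(Q *m _) _ _]mxE mulr_sumr.
    by apply: eq_bigr => j _; rewrite !mxE; ring.
  apply: eq_bigr => k _; rewrite (bigD1 k)//= big1 ?addr0.
    rewrite [(Q *m _) _ _]mxE -expr2; congr (_ * _).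
    by apply: eq_bigr => j _; rewrite !mxE expr2.
  by move=> l lk; rewrite QD ?mulr0// eq_sym.
apply: (@le_trans _ _ (theta * \sum_k Num.sqrt (sqnorm (a k) * sqnorm (b k)))).
  by rewrite h1 mulr_sumr; apply: ler_sum => k _; exact: Xt.
rewrite -mulrA ler_wpM2l//.
rewrite -ler_sqr ?nnegrE ?mulr_ge0 ?sqrtr_ge0 ?frob_norm_ge0//; last first.
  by apply: sumr_ge0 => k _; exact: sqrtr_ge0.
rewrite exprMn sqr_sqrtr ?ler0n// frob_normE h2.
have := sqr_sum_le (fun _ => 1) (fun k => Num.sqrt (sqnorm (a k) * sqnorm (b k))).
under eq_bigr do rewrite mul1r.
rewrite expr1n sumr_const card_ord.
move/le_trans; apply; rewrite ler_wpM2l ?ler0n//.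
by apply: ler_sum => k _; rewrite sqr_sqrtr ?mulr_ge0 ?sqnorm_ge0.
Qed.

End LowRank.

(** * A weighted grid in the unit ball *)

Section Net.
Context {R : realType} {n' : nat}.
Let n := n'.+1.

(** Points of the grid of step 1 / (4 sqrt n), given by sign and magnitude. Magnitudes up to 4n
    suffice because a coordinate of a unit vector needs at most 4 sqrt n steps. *)
Definition net := {ffun 'I_n -> bool * 'I_(4 * n).+1}.

Definition mesh : R := 4 * Num.sqrt n%:R.

Definition nvec (z : net) : 'rV[R]_n := \row_i (sgb (z i).1 * (z i).2%:R / mesh).

(** Gaussian-type weights that count grid points without volumes: their total factors over
    coordinates and is at most 4^n, while a point of the unit ball has integer coordinates of square
    sum at most 16n, hence weight at least 2^(-16n). *)
Definition netw (z : net) : R := \prod_i 2^-1 ^+ ((z i).2 ^ 2).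

Lemma mesh_gt0 : 0 < mesh.
Proof. by rewrite mulr_gt0// sqrtr_gt0 ltr0n. Qed.

Lemma mesh_sqr : mesh ^+ 2 = 16 * n%:R.
Proof. by rewrite exprMn sqr_sqrtr ?ler0n//; congr (_ * _); rewrite -natrX. Qed.

Lemma mesh_le : mesh <= (4 * n)%:R.
Proof.
rewrite natrM ler_wpM2l// -ler_sqr ?nnegrE ?sqrtr_ge0 ?ler0n//.
by rewrite sqr_sqrtr ?ler0n// -natrX ler_nat leq_pmulr.
Qed.

Lemma coord_le1 (u : 'rV[R]_n) i : sqnorm u <= 1 -> `|u 0 i| <= 1.
Proof.
move=> u1; rewrite -ler_sqr ?nnegrE// expr1n real_normK ?num_real//.
apply: le_trans u1; rewrite /sqnorm (bigD1 i)//= lerDl.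
by apply: sumr_ge0 => j _; exact: sqr_ge0.
Qed.

(** Coordinates are rounded toward 0, so the norm does not grow; each error is at most 1 / [mesh],
    and n / [mesh]^2 = 1/16. *)
Lemma net_approx (u : 'rV[R]_n) : sqnorm u <= 1 ->
  exists z, sqnorm (nvec z) <= 1 /\ sqnorm (u - nvec z) <= 16^-1.
Proof.
move=> u1; have m0 := mesh_gt0.
have ui i : `|u 0 i| <= 1 by exact: coord_le1.
have tr i : (Num.truncn (mesh * `|u 0 i|))%:R <= mesh * `|u 0 i| <
            (Num.truncn (mesh * `|u 0 i|)).+1%:R.
  by apply: truncn_itv; rewrite mulr_ge0// ltW.
have tb i : (Num.truncn (mesh * `|u 0%R i|)%R < (4 * n).+1)%N.
  rewrite ltnS -(ler_nat R); case/andP: (tr i) => + _; move/le_trans; apply.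
  by apply: le_trans mesh_le; rewrite ler_piMr// ltW.
exists [ffun i => (0 <= u 0 i, Ordinal (tb i))]; split.
  apply: le_trans u1; apply: ler_sum => i _; rewrite mxE ffunE /=.
  rewrite !exprMn expr2 sgb_mul mul1r -exprMn -[leRHS]real_normK ?num_real//.
  rewrite lerXn2r ?nnegrE ?divr_ge0 ?ler0n ?(ltW m0)//.
  by have /andP[k1 _] := tr i; rewrite ler_pdivrMr// [leRHS]mulrC.
apply: (@le_trans _ _ (\sum_(i < n) (mesh ^+ 2)^-1)).
  apply: ler_sum => i _; rewrite !mxE ffunE /=.
  set k := Num.truncn _.
  have -> : (u 0 i - sgb (0 <= u 0 i) * k%:R / mesh) ^+ 2 = (`|u 0 i| - k%:R / mesh) ^+ 2.
    by rewrite /sgb; case: ger0P => _; ring.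
  rewrite -exprVn; have /andP[k1 k2] := tr i; rewrite -/k in k1 k2.
  have h0 : 0 <= `|u 0 i| - k%:R / mesh by rewrite subr_ge0 ler_pdivrMr// mulrC.
  rewrite lerXn2r ?nnegrE ?invr_ge0 ?(ltW m0)//.
  rewrite lerBlDr -[X in X + _]mul1r -mulrDl ler_pdivlMr// mulrC ltW//.
  by rewrite -[1 + _](natrD _ 1 k) add1n.
rewrite sumr_const card_ord mesh_sqr -[_ *+ n]mulr_natr invfM -mulrA mulVf ?mulr1//.
by rewrite gt_eqF// ltr0n.
Qed.

Lemma sum_netw : \sum_z netw z <= 4 ^+ n.
Proof.
rewrite /netw -(bigA_distr_bigA (fun _ (v : bool * 'I_(4 * n).+1) => 2^-1 ^+ (v.2 ^ 2))) /=.
rewrite prodr_const card_ord lerXn2r ?nnegrE//.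
  by apply: sumr_ge0 => v _; rewrite exprn_ge0.
rewrite -(pair_big xpredT xpredT (fun (b : bool) (k : 'I_(4 * n).+1) => 2^-1 ^+ (k ^ 2)))/=.
rewrite sumr_const card_bool.
suff : \sum_(k < (4 * n).+1) (2^-1 : R) ^+ (k ^ 2) <= 2 by lra.
apply: (@le_trans _ _ (\sum_(k < (4 * n).+1) 2^-1 ^+ k)).
  apply: ler_sum => k _; apply: ler_wiXn2l; [lra|lra|].
  by case: (nat_of_ord k) => // j; rewrite -mulnn leq_pmulr.
suff -> : forall m, \sum_(k < m) (2^-1 : R) ^+ k = 2 - 2 * 2^-1 ^+ m.
  by rewrite gerBl mulr_ge0// exprn_ge0.
elim=> [|m IH]; first by rewrite big_ord0 expr0; ring.
by rewrite big_ord_recr/= IH exprS; field.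
Qed.

Lemma netw_ge z : sqnorm (nvec z) <= 1 -> 1 <= 2 ^+ (16 * n) * netw z.
Proof.
have -> : sqnorm (nvec z) = (\sum_i (z i).2 ^ 2)%:R / mesh ^+ 2.
  rewrite natr_sum mulr_suml; apply: eq_bigr => i _.
  by rewrite mxE [LHS]exprMn exprMn [sgb _ ^+ 2]expr2 sgb_mul mul1r exprVn natrX.
rewrite ler_pdivrMr ?exprn_gt0 ?mesh_gt0// mul1r mesh_sqr -natrM ler_nat => h.
rewrite /netw -expr_sum exprVn ler_pdivlMr ?exprn_gt0// mul1r.
by rewrite ler_eXn2l// ltr1n.
Qed.

Lemma netw_ge0 z : 0 <= netw z.
Proof. by apply: prodr_ge0 => i _; rewrite exprn_ge0. Qed.

(** Here [s] is the operator norm, as a supremum over two unit balls. It is at most twice the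
    maximum over the net, and the power of the maximum is one term of a sum whose terms are
    nonnegative because the exponent is even. *)
Lemma net_bound (Y : 'M[R]_n) q : (0 < q)%N ->
  exists s, [/\ 0 <= s, forall u v, bform Y u v <= s * Num.sqrt (sqnorm u * sqnorm v) &
   s ^+ (2 * q) <= \sum_(z | sqnorm (nvec z) <= 1) \sum_(z' | sqnorm (nvec z') <= 1)
     (2 * bform Y (nvec z) (nvec z')) ^+ (2 * q)].
Proof.
move=> q0; pose P (z : net * net) := (sqnorm (nvec z.1) <= 1) && (sqnorm (nvec z.2) <= 1).
pose f (z : net * net) := bform Y (nvec z.1) (nvec z.2).
have sq00 k : sqnorm (0 : 'rV[R]_k) = 0 by rewrite /sqnorm big1// => i _; rewrite mxE expr0n.
have [z0 [z01 _]] : exists z, sqnorm (nvec z) <= 1 /\ sqnorm (0 - nvec z) <= 16^-1.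
  by apply: net_approx; rewrite sq00.
have Pz0 : P (z0, z0) by rewrite /P z01.
case: (@arg_maxP _ R _ (z0, z0) P f Pz0) => zm Pzm fm.
pose m := Num.max 0 (f zm).
have m0 : 0 <= m by rewrite le_max lexx.
have fleq z : P z -> f z <= m by move=> Pz; have /= h := fm z Pz; rewrite le_max h orbT.
pose A := [set r | exists u v, [/\ sqnorm u <= 1, sqnorm v <= 1 & r = bform Y u v]]%classic.
have qf0 u : bform Y u 0 = 0 by rewrite /bform trmx0 mulmx0 mxE.
have A0 : A 0 by exists 0, 0; rewrite !sq00 qf0 ler01.
have Aub : has_ubound A.
  exists (\sum_(e : 'I_n * 'I_n) `|Y e.1 e.2|) => _ [u [v [u1 v1 ->]]].
  have coord (w : 'rV[R]_n) i : sqnorm w <= 1 -> `|w 0 i| <= 1 by exact: coord_le1.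
  rewrite bformE; apply: ler_sum => e _; apply: le_trans (ler_norm _) _.
  by rewrite !normrM ler_piMl// mulr_ile1// coord.
pose s := sup A.
have As r : A r -> r <= s by exact: ub_le_sup.
have s0 : 0 <= s by exact: As.
have s2m : s <= 2 * m.
  (* An approximation error has squared norm at most 1/16, so four times it lies in the unit ball:
     each of the two errors costs at most s / 4. *)
  suff : s <= m + s / 2 by lra.
  apply: ge_sup; first by exists 0.
  move=> _ [u [v [u1 v1 ->]]].
  have [z [z1 uz]] := net_approx u1; have [z' [z'1 vz]] := net_approx v1.
  have -> : bform Y u v = f (z, z') + (bform Y (u - nvec z) v + bform Y (nvec z) (v - nvec z')).
    by rewrite /f /bform /= linearB/= !mulmxBl mulmxBr !mxE; ring.
  have quart (w : 'rV[R]_n) : sqnorm w <= 16^-1 -> sqnorm (4 *: w) <= 1.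
    by rewrite sqnormZ; lra.
  have h1 : 4 * bform Y (u - nvec z) v <= s.
    apply: As; exists (4 *: (u - nvec z)), v; split; rewrite ?quart//.
    by rewrite /bform -!scalemxAl [RHS]mxE.
  have h2 : 4 * bform Y (nvec z) (v - nvec z') <= s.
    apply: As; exists (nvec z), (4 *: (v - nvec z')); split; rewrite ?quart//.
    by rewrite /bform linearZ/= -scalemxAr [RHS]mxE.
  have : f (z, z') <= m by apply: fleq; rewrite /P /= z1 z'1.
  lra.
exists s; split => //.
  move=> u v; have [u0|u0] := eqVneq (sqnorm u) 0.
    rewrite u0 mul0r sqrtr0 mulr0.
    have -> : u = 0; last by rewrite /bform !mul0mx mxE.
    apply/rowP => i; rewrite mxE; apply/eqP; rewrite -sqrf_eq0.
    move/eqP: u0; rewrite psumr_eq0 => [/allP/(_ i)|j _]; last exact: sqr_ge0.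
    by rewrite mem_index_enum => /(_ isT).
  have [v0|v0] := eqVneq (sqnorm v) 0.
    rewrite v0 mulr0 sqrtr0 mulr0.
    have -> : v = 0; last by rewrite qf0.
    apply/rowP => i; rewrite mxE; apply/eqP; rewrite -sqrf_eq0.
    move/eqP: v0; rewrite psumr_eq0 => [/allP/(_ i)|j _]; last exact: sqr_ge0.
    by rewrite mem_index_enum => /(_ isT).
  have u0' : 0 < sqnorm u by rewrite lt_neqAle eq_sym u0 sqnorm_ge0.
  have v0' : 0 < sqnorm v by rewrite lt_neqAle eq_sym v0 sqnorm_ge0.
  have su : 0 < Num.sqrt (sqnorm u) by rewrite sqrtr_gt0.
  have sv : 0 < Num.sqrt (sqnorm v) by rewrite sqrtr_gt0.
  rewrite sqrtrM ?sqnorm_ge0// -ler_pdivrMr ?mulr_gt0//; apply: As.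
  exists ((Num.sqrt (sqnorm u))^-1 *: u), ((Num.sqrt (sqnorm v))^-1 *: v); split.
  - by rewrite sqnormZ exprVn sqr_sqrtr ?sqnorm_ge0// mulVf.
  - by rewrite sqnormZ exprVn sqr_sqrtr ?sqnorm_ge0// mulVf.
  - have sc c (Z : 'M[R]_1) : (c *: Z) 0 0 = c * Z 0 0 by rewrite mxE.
    by rewrite {2}/bform linearZ/= -!scalemxAl -scalemxAr !sc -/(bform Y u v) invfM; ring.
apply: (@le_trans _ _ ((2 * f zm) ^+ (2 * q))).
  have : s ^+ (2 * q) <= (2 * m) ^+ (2 * q) by rewrite lerXn2r// nnegrE ?mulr_ge0.
  move/le_trans; apply; rewrite /m maxEle; case: ifP => // _.
  rewrite mulr0 expr0n muln_eq0/= (gtn_eqF q0) exprM exprn_ge0// sqr_ge0//.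
move: Pzm; case: zm {fm m m0 fleq s2m} => z z' /andP[/= Pz Pz'].
have p0 (x : R) : 0 <= x ^+ (2 * q) by rewrite exprM exprn_ge0// sqr_ge0.
rewrite (bigD1 z)//= (bigD1 z')//= -addrA lerDl addr_ge0//.
  by apply: sumr_ge0 => ? _; exact: p0.
by apply: sumr_ge0 => ? _; apply: sumr_ge0 => ? _; exact: p0.
Qed.

(** Each of the n diagonal entries is bounded by the norm of its row, the image of a unit vector
    under [(Y *m Y^T) ^+ q]. *)
Lemma trpow_le (Y : 'M[R]_n) (s : R) q : 0 <= s ->
  (forall u v, bform Y u v <= s * Num.sqrt (sqnorm u * sqnorm v)) ->
  trpow Y q <= n%:R * s ^+ (2 * q).
Proof.
move=> s0 Ys.
have sqm (Z : 'M[R]_n) : (forall u v, bform Z u v <= s * Num.sqrt (sqnorm u * sqnorm v)) ->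
    forall u, sqnorm (u *m Z) <= s ^+ 2 * sqnorm u.
  move=> Zs u; have := Zs u (u *m Z); rewrite /bform -sqnormE sqrtrM ?sqnorm_ge0//.
  set a := sqnorm (u *m Z); have a0 : 0 <= a := sqnorm_ge0 _.
  have [->|aN] := eqVneq a 0; first by move=> _; apply: mulr_ge0; [exact: sqr_ge0|exact: sqnorm_ge0].
  have sa : 0 < Num.sqrt a by rewrite sqrtr_gt0 lt_neqAle eq_sym aN.
  rewrite -{1}(sqr_sqrtr a0) expr2 mulrA ler_pM2r// => h.
  rewrite -(sqr_sqrtr a0) -(sqr_sqrtr (sqnorm_ge0 u)) -exprMn.
  by rewrite lerXn2r ?nnegrE ?mulr_ge0 ?sqrtr_ge0.
have YT u v : bform Y^T u v <= s * Num.sqrt (sqnorm u * sqnorm v) by rewrite bformT [sqnorm u * _]mulrC.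
have pw k u : sqnorm (u *m (Y *m Y^T) ^+ k) <= s ^+ (4 * k) * sqnorm u.
  elim: k u => [|k IH] u; first by rewrite muln0 !expr0 mulmx1 mul1r.
  rewrite exprS -mulmxE mulmxA; apply: le_trans (IH _) _.
  rewrite mulnS exprD [s ^+ 4 * _]mulrC -mulrA; apply: ler_wpM2l; rewrite ?exprn_ge0//.
  rewrite mulmxA; apply: le_trans (sqm _ YT _) _.
  rewrite (exprD s 2 2) -mulrA ler_wpM2l ?sqr_ge0//; exact: sqm.
rewrite /trpow /mxtrace -[n in n%:R]card_ord -sum1_card natr_sum mulr_suml.
apply: ler_sum => i _; rewrite mul1r.
have := pw q (delta_mx 0 i).
rewrite -rowE; set S := _ ^+ q => h.
apply: le_trans (ler_norm _) _.
rewrite -ler_sqr ?nnegrE ?exprn_ge0// -exprM real_normK ?num_real//.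
have -> : (2 * q * 2 = 4 * q)%N by lia.
apply: (@le_trans _ _ (sqnorm (row i S))).
  rewrite /sqnorm (bigD1 i)//= mxE lerDl.
  by apply: sumr_ge0 => j _; exact: sqr_ge0.
apply: le_trans h _; rewrite (_ : sqnorm _ = 1) ?mulr1//.
rewrite /sqnorm (bigD1 i)//= big1 ?addr0; first by rewrite mxE !eqxx expr1n.
by move=> j /negPf ji; rewrite mxE ji andbF expr0n.
Qed.

End Net.

(** * From trace moments to the operator norm *)

Section Spectral.
Context {R : realType}.

Lemma pexp_qf_moment (p : R) m n (u : 'rV_m) (v : 'rV_n) q : 0 <= p <= 1 ->
  sqnorm u <= 1 -> sqnorm v <= 1 -> (0 < q)%N ->
  pexp (sign_law p) (fun x => bform (sign_mx x) u v ^+ (2 * q)) <= 2 * (4 * q%:R) ^+ q.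
Proof.
move=> p01 u1 v1 q0.
have uv1 : \sum_(e : 'I_m * 'I_n) (u 0 e.1 * v 0 e.2) ^+ 2 <= 1.
  rewrite -(pair_big xpredT xpredT (fun i j => (u 0 i * v 0 j) ^+ 2))/=.
  under eq_bigr => i _.
    under eq_bigr do rewrite exprMn.
    rewrite -mulr_sumr. over.
  by rewrite -mulr_suml mulr_ile1// sqnorm_ge0.
apply: le_trans (pexp_moment p01 uv1 q0); rewrite le_eqVlt; apply/orP; left; apply/eqP.
apply: eq_pexp => x; rewrite bformE; congr (_ ^+ _); apply: eq_bigr => -[i j] _.
by rewrite mxE.
Qed.

Lemma sign_law1_ge0 v : 0 <= sign_law (1 : R) v.
Proof. by apply: sign_law_ge0; rewrite ler01 lexx. Qed.

Lemma pexp_trpow_signs n' q : (0 < q)%N ->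
  pexp (sign_law 1) (fun x => trpow (@sign_mx R n'.+1 n'.+1 x) q) <=
  n'.+1%:R * (2 ^+ (36 * n'.+1) * (2 * (16 * q%:R) ^+ q)).
Proof.
set n := n'.+1; move=> q0.
pose good (z : @net n') := sqnorm (nvec z : 'rV[R]_n) <= 1.
(* Since [c z] is at least 1 on the unit ball, inserting it only increases the sum; its total is at
   most 2^(18n), and the pairs of net points give the exponent 36. *)
pose c (z : @net n') : R := 2 ^+ (16 * n) * netw z.
have c0 z : 0 <= c z by rewrite mulr_ge0 ?exprn_ge0// netw_ge0.
have p0 (y : R) : 0 <= y ^+ (2 * q) by rewrite exprM; apply: exprn_ge0; exact: sqr_ge0.
apply: (@le_trans _ _ (pexp (sign_law 1) (fun x => n%:R *
    \sum_(z | good z) c z * \sum_(z' | good z') c z' *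
       (2 ^+ (2 * q) * bform (sign_mx x) (nvec z) (nvec z') ^+ (2 * q))))).
  apply: (pexp_le sign_law1_ge0) => x; have [s [s0 xs hs]] := @net_bound R n' (sign_mx x) q q0.
  apply: le_trans (trpow_le q s0 xs) _; rewrite ler_wpM2l ?ler0n//.
  apply: le_trans hs _; apply: ler_sum => z gz.
  apply: (@le_trans _ _ (1 * \sum_(z' | good z') c z' *
       (2 ^+ (2 * q) * bform (sign_mx x) (nvec z) (nvec z') ^+ (2 * q)))).
    rewrite mul1r; apply: ler_sum => z' gz'; rewrite -exprMn ler_peMl//.
    exact: netw_ge.
  rewrite ler_wpM2r//; last exact: netw_ge.
  by apply: sumr_ge0 => z' _; rewrite -exprMn mulr_ge0.
rewrite pexpZ ler_wpM2l ?ler0n// pexp_sum.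
apply: (@le_trans _ _ (\sum_(z | good z) c z * \sum_(z' | good z') c z' *
   (2 ^+ (2 * q) * (2 * (4 * q%:R) ^+ q)))).
  apply: ler_sum => z gz; rewrite pexpZ ler_wpM2l// pexp_sum; apply: ler_sum => z' gz'.
  rewrite pexpZ ler_wpM2l// pexpZ ler_wpM2l ?exprn_ge0//.
  by apply: pexp_qf_moment; rewrite ?ler01 ?lexx.
have sc : \sum_(z | good z) c z <= 2 ^+ (18 * n).
  apply: (@le_trans _ _ (\sum_z c z)).
    by rewrite [leRHS](bigID good)/= lerDl sumr_ge0.
  rewrite -mulr_sumr (_ : 18 * n = 16 * n + 2 * n)%N; last by lia.
  rewrite exprD ler_wpM2l ?exprn_ge0// exprM (_ : 2 ^+ 2 = 4 :> R); last by rewrite -natrX.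
  exact: sum_netw.
set D : R := 2 ^+ (2 * q) * _.
have -> : (2 : R) ^+ (36 * n) * (2 * (16 * q%:R) ^+ q) = 2 ^+ (18 * n) * (2 ^+ (18 * n) * D).
  rewrite [RHS]mulrA -exprD (_ : 18 * n + 18 * n = 36 * n)%N; last by lia.
  congr (_ * _); rewrite /D mulrCA; congr (_ * _); rewrite exprM -exprMn mulrA.
  by congr ((_ * _) ^+ _); rewrite -natrX -natrM.
have D0 : 0 <= D by rewrite !mulr_ge0 ?exprn_ge0 ?mulr_ge0 ?ler0n.
rewrite -mulr_suml -mulr_suml ler_pM//; first exact: sumr_ge0.
  by rewrite mulr_ge0// sumr_ge0.
by rewrite ler_wpM2r.
Qed.

(** Size 2q + 1 leaves q free labels once q + 1 are set aside for a walk. As it is at most 3q, the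
    exponent is 116 = 3 + 108 + 1 + 4, from the dimension, the net, the factor 2 and 16^q. *)
Lemma pexp_trpow_signs_simpl q : (0 < q)%N ->
  pexp (sign_law 1) (fun x => trpow (@sign_mx R (2 * q).+1 (2 * q).+1 x) q) <=
  (2 ^+ 116 * q%:R) ^+ q.
Proof.
move=> q0; apply: le_trans (pexp_trpow_signs _ q0) _; set n := (2 * q).+1.
have nq : (n <= 3 * q)%N by rewrite /n; lia.
have n2 : (n <= 2 ^ n)%N by apply: ltnW; exact: ltn_expl.
apply: (@le_trans _ _ (2 ^+ (3 * q) * (2 ^+ (108 * q) * (2 ^+ q * (2 ^+ (4 * q) * q%:R ^+ q))))).
  apply: ler_pM; rewrite ?ler0n ?mulr_ge0 ?exprn_ge0 ?mulr_ge0 ?exprn_ge0 ?mulr_ge0 ?ler0n//.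
    by rewrite -natrX ler_nat (leq_trans n2)// leq_exp2l.
  apply: ler_pM; rewrite ?exprn_ge0 ?mulr_ge0 ?exprn_ge0 ?mulr_ge0 ?ler0n//.
    by rewrite ler_eXn2l ?ltr1n//; lia.
  rewrite (_ : (16 * q%:R) ^+ q = 2 ^+ (4 * q) * q%:R ^+ q :> R); last first.
    by rewrite exprM -exprMn -natrX.
  apply: ler_wpM2r; first by rewrite mulr_ge0 ?exprn_ge0 ?ler0n.
  by rewrite -[leLHS]expr1 ler_eXn2l ?ltr1n.
rewrite exprMn -exprM !mulrA -!exprD.
by rewrite (_ : 3 * q + 108 * q + q + 4 * q = 116 * q)%N//; lia.
Qed.

(** The trace moment bounds the 2q-th power of the operator norm y. Either y <= L or y <= y^(2q) /
    L^(2q-1), so [L + tau x / L ^+ (2 * q).-1] dominates y; it is linear in the trace, and its mean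
    is at most 2L without taking roots. *)
Lemma spectral_bound (p : R) m1 m2 t : let q := (2 ^ t)%N in
  let L := Num.sqrt (2 ^+ 118 * q%:R) in
  0 < p -> p <= 1 -> p * m1.+1%:R <= q%:R -> p * m2.+1%:R <= q%:R ->
  p^-1 <= 4 ^+ q ->
  exists g : {ffun 'I_m1.+1 * 'I_m2.+1 -> bool * bool} -> R,
  [/\ forall x, 0 <= g x,
   forall x u v, bform (sign_mx x) u v <= g x * Num.sqrt (sqnorm u * sqnorm v) &
   pexp (sign_law p) g <= 2 * L].
Proof.
move=> q L p0 p1 pm1 pm2 pq.
have q0 : (0 < q)%N by rewrite expn_gt0.
have p01 : 0 <= p <= 1 by rewrite p1 ltW.
have L20 : 0 < 2 ^+ 118 * q%:R :> R by rewrite mulr_gt0 ?exprn_gt0 ?ltr0n.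
have L0 : 0 < L by rewrite sqrtr_gt0.
have L2 : L ^+ 2 = 2 ^+ 118 * q%:R by rewrite sqr_sqrtr// ltW.
pose tau (x : {ffun 'I_m1.+1 * 'I_m2.+1 -> bool * bool}) := trpow (@sign_mx R _ _ x) q.
have sqd n : sqnorm (delta_mx 0 0 : 'rV[R]_n.+1) = 1.
  rewrite /sqnorm (bigD1 0)//= big1 ?addr0; first by rewrite mxE !eqxx expr1n.
  by move=> j /negPf j0; rewrite mxE j0 andbF expr0n.
have p00 (y : R) : 0 <= y ^+ (2 * q) by rewrite exprM; apply: exprn_ge0; exact: sqr_ge0.
have tau0 x : 0 <= tau x.
  have := bform_trpow (@sign_mx R _ _ x) t (delta_mx 0 0) (delta_mx 0 0).
  by rewrite !sqd mulr1 expr1n mul1r; apply: le_trans.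
have Etau : pexp (sign_law p) tau <= L ^+ (2 * q).
  rewrite exprM L2.
  have := @pexp_trpow_compare R p m1 m2 (2 * q) q p01.
  rewrite (_ : (2 * q).+1 - q.+1 = q)%N; last by lia.
  move=> /(_ _ pm1 pm2) H; have {}H := H ltac:(lia).
  have {}H := le_trans H (pexp_trpow_signs_simpl q0).
  rewrite -(ler_pM2l p0); apply: le_trans H _.
  (* The extra 4 absorbs the lost 1 / p, which is at most 4^q. *)
  have -> : 2 ^+ 118 * q%:R = 4 * (2 ^+ 116 * q%:R) :> R.
    by rewrite mulrA (_ : 4 = 2 ^+ 2) -?exprD// -natrX.
  rewrite [X in p * X]exprMn mulrA ler_peMl//.
  by rewrite -ler_pdivrMl ?mulr1.
exists (fun x => L + tau x / L ^+ (2 * q).-1); split.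
- by move=> x; rewrite addr_ge0 ?divr_ge0 ?exprn_ge0 ?(ltW L0)//.
- move=> x u v; have := bform_trpow (@sign_mx R _ _ x) t u v; rewrite -/q -/(tau x).
  have N0 : 0 <= sqnorm u * sqnorm v by rewrite mulr_ge0 ?sqnorm_ge0.
  rewrite -[_ ^+ (2 * q)]ger0_norm// normrX.
  move=> h; apply: le_trans (ler_norm _) _; move: h; move: (`|bform _ _ _|) (normr_ge0 (bform (sign_mx x) u v)) => a a0 h.
  have sN := sqr_sqrtr N0; set N := Num.sqrt _ in sN *.
  have [N00|N00] := eqVneq N 0.
    rewrite N00 mulr0; move: h; rewrite -sN N00 expr0n/= expr0n (gtn_eqF q0) mul0r => h.
    rewrite leNgt; apply/negP => a1.
    by have := exprn_gt0 (2 * q) a1; rewrite ltNge h.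
  have Np : 0 < N by rewrite lt_neqAle eq_sym N00 sqrtr_ge0.
  move: h; rewrite -sN -exprM => h.
  rewrite -ler_pdivrMr//; set y := a / N.
  have y0 : 0 <= y by rewrite divr_ge0// ltW.
  have yt : y ^+ (2 * q) <= tau x.
    by rewrite exprMn exprVn ler_pdivrMr ?exprn_gt0// mulrC.
  have [yL|Ly] := lerP y L.
    by rewrite (le_trans yL)// lerDl divr_ge0// exprn_ge0// ltW.
  apply: (@le_trans _ _ (tau x / L ^+ (2 * q).-1)); last by rewrite lerDr ltW.
  rewrite ler_pdivlMr ?exprn_gt0//; apply: le_trans yt.
  rewrite -[in leRHS](prednK (_ : 0 < 2 * q)%N) ?muln_gt0// exprS ler_wpM2l//.
  by rewrite lerXn2r ?nnegrE ?(ltW L0)// ltW.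
- under eq_pexp do rewrite mulrC.
  rewrite pexpD pexpZ pexp_cst; last exact: sign_law_sum1.
  rewrite mulr2n mulrDl mul1r lerD2l ler_pdivrMl ?exprn_gt0// mulrC.
  by rewrite -exprS prednK ?muln_gt0.
Qed.

End Spectral.

(** * A contraction principle for centered Bernoulli variables *)

Local Open Scope classical_set_scope.
Local Open Scope ring_scope.

Section SetSup.
Context {R : realType} {K : Type}.
Variable T : set K.
Hypothesis T0 : T !=set0.

Definition supT (f : K -> R) : R := sup [set f t | t in T].

Definition bddT (f : K -> R) := exists B, forall t, T t -> f t <= B.

Lemma supT_ge f t : bddT f -> T t -> f t <= supT f.
Proof. by move=> [B fB] Tt; apply: ub_le_sup; [exists B => _ [s Ts <-]; exact: fB|exists t]. Qed.

Lemma supT_le f B : (forall t, T t -> f t <= B) -> supT f <= B.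
Proof. by move=> fB; apply: ge_sup; [exact: image_nonempty|move=> _ [t Tt <-]; exact: fB]. Qed.

Lemma supT_comb f g p q c : 0 <= p -> 0 <= q ->
  (forall t t', T t -> T t' -> p * f t + q * g t' <= c) ->
  p * supT f + q * supT g <= c.
Proof.
move=> p0 q0 H.
have bd r h t' e : 0 <= r -> T t' -> (forall t, T t -> r * h t + e <= c) ->
    r * supT h + e <= c.
  rewrite le_eqVlt => /orP[/eqP <-|r0] Tt' {}H.
    by have := H _ Tt'; rewrite !mul0r.
  rewrite -lerBrDr -ler_pdivlMl// mulrC; apply: supT_le => // t Tt.
  by rewrite ler_pdivlMr// mulrC lerBrDr; exact: H.
have [t0 Tt0] := T0.
apply: (bd _ _ t0) => // t Tt; rewrite addrC.
by apply: (bd _ _ t0) => // t' Tt'; rewrite addrC; exact: H.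
Qed.

(** Symmetrization and contraction at one coordinate, the others being frozen in [g]: the centered
    indicator times [phi] becomes a sparse sign times 2 [lip] [l]. The sign acts only with
    probability [p], so sparsity is preserved. It suffices to treat a pair of near-maximizers t, t'
    and to use [l] with the sign that favors their difference. *)
Lemma contraction_step (p lip : R) (g phi l : K -> R) :
  0 <= p <= 1 -> 0 <= lip -> bddT g ->
  bddT (fun t => g t + 2 * lip * l t) -> bddT (fun t => g t - 2 * lip * l t) ->
  (forall t t', T t -> T t' -> phi t' - phi t <= lip * `|l t' - l t|) ->
  p * supT (fun t => g t - (1 - p) * phi t) + (1 - p) * supT (fun t => g t + p * phi t) <=
  p / 2 * (supT (fun t => g t + 2 * lip * l t) + supT (fun t => g t - 2 * lip * l t)) +
  (1 - p) * supT g.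
Proof.
move=> /andP[p0 p1] lip0 bg bp bm hphi.
have q0 : 0 <= 1 - p by rewrite subr_ge0.
apply: supT_comb => // t t' Tt Tt'.
have g1 := supT_ge bg Tt; have g2 := supT_ge bg Tt'.
have a1 := supT_ge bp Tt; have a2 := supT_ge bp Tt'.
have b1 := supT_ge bm Tt; have b2 := supT_ge bm Tt'.
have := hphi _ _ Tt Tt'.
move: g1 g2 a1 a2 b1 b2.
set G := supT g; set A := supT _; set B := supT _ => /= g1 g2 a1 a2 b1 b2.
set D := lip * _ => hD.
have D0 : 0 <= D by rewrite mulr_ge0.
have hS : g t + g t' + 2 * D <= A + B.
  by rewrite /D; case: (ger0P (l t' - l t)) => _; lra.
have hS1 : 2 * g t <= A + B by lra.
have hD' : p * (1 - p) * (phi t' - phi t) <= p * (1 - p) * D.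
  by rewrite ler_wpM2l// mulr_ge0.
suff : p * g t + (1 - p) * g t' + p * (1 - p) * D <= p / 2 * (A + B) + (1 - p) * G by lra.
have h3 : (1 - p) * g t' <= (1 - p) * G by rewrite ler_wpM2l.
have h4 : (1 - p) * g t <= (1 - p) * G by rewrite ler_wpM2l.
have h5 : p / 2 * (g t + g t' + 2 * D) <= p / 2 * (A + B).
  by rewrite ler_wpM2l// divr_ge0.
have pD : p * (1 - p) * D <= p * D.
  by rewrite ler_wpM2r// ler_piMr//; lra.
have [gt|gt] := lerP (g t) (g t').
  have : p * g t <= p / 2 * (g t + g t') by rewrite -mulrA ler_wpM2l//; lra.
  lra.
(* When g t exceeds g t', the bound by G is spent on t, and the weight p is split as p(1-p) + p^2
   between the bound for the pair and the bound for t alone. *)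
have h6 : p * (1 - p) * (g t + g t' + 2 * D) <= p * (1 - p) * (A + B).
  by rewrite ler_wpM2l// mulr_ge0.
have h7 : p * p * (2 * g t) <= p * p * (A + B) by rewrite ler_wpM2l// mulr_ge0.
have : 0 <= (1 - p) * ((1 - p / 2) * (g t - g t')).
  by apply: mulr_ge0 => //; apply: mulr_ge0; lra.
nra.
Qed.

End SetSup.

Section SquareContraction.
Context {R : realType} {I : finType}.
Variables (p kappa : R) (T : set (I -> R)).
Hypothesis p01 : 0 <= p <= 1.
Hypothesis T0 : T !=set0.
Hypothesis Tk : forall t, T t -> forall i, `|t i| <= kappa.

Lemma kappa_ge0 (i : I) : 0 <= kappa.
Proof. by have [t Tt] := T0; apply: le_trans (normr_ge0 _) (Tk Tt i). Qed.

(** Interpolation between the two processes: coordinates in [s] are already linearized. The factor 4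
    [kappa] is 2 from symmetrization times the Lipschitz constant 2 [kappa] of the square on
    [-kappa, kappa]. *)
Definition hybrid (s : seq I) (x : {ffun I -> bool * bool}) (t : I -> R) : R :=
  \sum_i if i \in s then 4 * kappa * (sparse_sign (x i) * t i)
         else (p - (x i).1%:R) * t i ^+ 2.

Lemma bdd_sum (P : pred I) (f : I -> (I -> R) -> R) :
  (forall i, bddT T (f i)) -> bddT T (fun t => \sum_(i | P i) f i t).
Proof.
move=> /choice[B fB]; exists (\sum_(i | P i) B i) => t Tt.
by apply: ler_sum => i _; exact: fB.
Qed.

Lemma bddD (f g : (I -> R) -> R) : bddT T f -> bddT T g -> bddT T (fun t => f t + g t).
Proof. by move=> [B fB] [C gC]; exists (B + C) => t Tt; rewrite lerD ?fB ?gC. Qed.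

Lemma bdd_lin c i : bddT T (fun t => c * t i).
Proof.
exists (`|c| * kappa) => t Tt; apply: le_trans (ler_norm _) _.
by rewrite normrM ler_wpM2l// Tk.
Qed.

Lemma bdd_sqr c i : bddT T (fun t => c * t i ^+ 2).
Proof.
exists (`|c| * kappa ^+ 2) => t Tt; apply: le_trans (ler_norm _) _.
rewrite normrM ler_wpM2l// normrX lerXn2r ?nnegrE ?Tk//; exact: kappa_ge0.
Qed.

Let mu0 := sign_law_ge0 p01.

Lemma hybrid_step s k : k \notin s ->
  pexp (sign_law p) (fun x => supT T (hybrid s x)) <= pexp (sign_law p) (fun x => supT T (hybrid (k :: s) x)).
Proof.
move=> ks; rewrite (pexp_resample (sign_law_sum1 p) k) [leRHS](pexp_resample (sign_law_sum1 p) k).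
apply: (pexp_le mu0) => x; rewrite !sum_bool_pair /sign_law /=.
pose g (t : I -> R) := \sum_(i | i != k) if i \in s then 4 * kappa * (sparse_sign (x i) * t i)
         else (p - (x i).1%:R) * t i ^+ 2.
have hE v : supT T (hybrid s (resample k v x)) =
    supT T (fun t => g t + (p - v.1%:R) * t k ^+ 2).
  congr (sup _); congr image; apply/funext => t.
  rewrite /hybrid (bigD1 k)//= (negPf ks) ffunE eqxx addrC; congr (_ + _).
  by apply: eq_bigr => i /negPf ik; rewrite ffunE ik.
have hE' v : supT T (hybrid (k :: s) (resample k v x)) =
    supT T (fun t => g t + 4 * kappa * (sparse_sign v * t k)).
  congr (sup _); congr image; apply/funext => t.
  rewrite /hybrid (bigD1 k)//= inE eqxx /= ffunE eqxx addrC; congr (_ + _).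
  by apply: eq_bigr => i /negPf ik; rewrite ffunE ik inE ik.
rewrite !hE !hE' /sparse_sign /sgb /=.
have bg : bddT T g.
  apply: bdd_sum => i; case: (i \in s); last exact: bdd_sqr.
  by have [C h] := bdd_lin (4 * kappa * sparse_sign (x i)) i; exists C => t Tt; rewrite mulrA; exact: h.
have k0 := kappa_ge0 k.
have step := @contraction_step R _ T T0 p (2 * kappa) g (fun t => t k ^+ 2) (fun t => t k) p01.
have {}step := step ltac:(by rewrite mulr_ge0) bg.
have bl c : bddT T (fun t => g t + c * t k) by apply: bddD => //; exact: bdd_lin.
have {}step := step (bl _).
have bm : bddT T (fun t => g t - 2 * (2 * kappa) * t k).
  by have [C h] := bl (- (2 * (2 * kappa))); exists C => t Tt; rewrite -mulNr; exact: h.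
have {}step := step bm.
have Lip t t' : T t -> T t' -> t' k ^+ 2 - t k ^+ 2 <= 2 * kappa * `|t' k - t k|.
  move=> Tt Tt'; rewrite subr_sqr mulrC; apply: le_trans (ler_norm _) _.
  rewrite normrM ler_wpM2r//; apply: le_trans (ler_normD _ _) _.
  by have := Tk Tt k; have := Tk Tt' k; lra.
have {}step := step Lip.
have e1 : (fun t : I -> R => g t + (p - 1) * t k ^+ 2) = (fun t => g t - (1 - p) * t k ^+ 2).
  by apply/funext => t; ring.
have e2 : (fun t : I -> R => g t + (p - 0) * t k ^+ 2) = (fun t => g t + p * t k ^+ 2).
  by apply/funext => t; ring.
have e3 : (fun t : I -> R => g t + 4 * kappa * (1 * t k)) = (fun t => g t + 2 * (2 * kappa) * t k).
  by apply/funext => t; ring.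
have e4 : (fun t : I -> R => g t + 4 * kappa * (-1 * t k)) = (fun t => g t - 2 * (2 * kappa) * t k).
  by apply/funext => t; ring.
have e5 : (fun t : I -> R => g t + 4 * kappa * (0 * t k)) = g.
  by apply/funext => t; ring.
rewrite e1 e2 e3 e4 e5; lra.
Qed.

Lemma square_contraction :
  pexp (sign_law p) (fun x => supT T (fun t => \sum_i (p - (x i).1%:R) * t i ^+ 2)) <=
  pexp (sign_law p) (fun x => supT T (fun t => 4 * kappa * \sum_i sparse_sign (x i) * t i)).
Proof.
have H s : pexp (sign_law p) (fun x => supT T (hybrid [::] x)) <= pexp (sign_law p) (fun x => supT T (hybrid s x)).
  elim: s => // k s IH; apply: le_trans IH _.
  have [ks|ks] := boolP (k \in s); last exact: hybrid_step.
  rewrite le_eqVlt; apply/orP; left; apply/eqP; apply: eq_pexp => x.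
  congr (sup _); congr image; apply/funext => t; apply: eq_bigr => i _.
  by rewrite inE; case: eqP => // ->; rewrite ks.
apply: le_trans (H (enum I)) _.
rewrite le_eqVlt; apply/orP; left; apply/eqP; apply: eq_pexp => x.
congr (sup _); congr image; apply/funext => t; rewrite mulr_sumr; apply: eq_bigr => i _.
by rewrite mem_enum.
Qed.

End SquareContraction.

(** * Independence and conditional sign averages *)

Section BoundedExpectation.
Context {d : measure_display} {T : measurableType d} {R : realType}.
Variable P : probability T R.
Implicit Types f g : T -> R.

Definition bmeas f := measurable_fun setT f /\ exists M, forall w, `|f w| <= M.

Definition mean f : R := Rintegral P setT f.

Lemma bmeas_cst c : bmeas (fun=> c).
Proof. by split; [exact: measurable_cst|exists `|c|]. Qed.

Lemma bmeasD f g : bmeas f -> bmeas g -> bmeas (fun w => f w + g w).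
Proof.
move=> [mf [M fM]] [mg [N gN]]; split; first exact: measurable_funD.
by exists (M + N) => w; rewrite (le_trans (ler_normD _ _))// lerD.
Qed.

Lemma bmeasM f g : bmeas f -> bmeas g -> bmeas (fun w => f w * g w).
Proof.
move=> [mf [M fM]] [mg [N gN]]; split; first exact: measurable_funM.
by exists (M * N) => w; rewrite normrM ler_pM.
Qed.

Lemma bmeas_sum (I : Type) (s : seq I) (F : I -> T -> R) :
  (forall i, bmeas (F i)) -> bmeas (fun w => \sum_(i <- s) F i w).
Proof.
move=> bF; elim: s => [|i s IH].
  by under eq_fun do rewrite big_nil; exact: bmeas_cst.
by under eq_fun do rewrite big_cons; exact: bmeasD.
Qed.

Lemma bmeas_prod (I : Type) (s : seq I) (F : I -> T -> R) :
  (forall i, bmeas (F i)) -> bmeas (fun w => \prod_(i <- s) F i w).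
Proof.
move=> bF; elim: s => [|i s IH].
  by under eq_fun do rewrite big_nil; exact: bmeas_cst.
by under eq_fun do rewrite big_cons; exact: bmeasM.
Qed.

Lemma bmeas_indic (A : set T) : measurable A -> bmeas (\1_A : T -> R).
Proof.
move=> mA; split; first exact: measurable_indic.
by exists 1 => w; rewrite indicE; case: (_ \in _); rewrite ?normr1 ?normr0.
Qed.

Lemma bmeas_integrable f : bmeas f -> P.-integrable setT (EFin \o f).
Proof.
move=> [mf [M fM]]; apply: (measurable_bounded_integrable measurableT _ mf).
  by rewrite -ge0_fin_numE// fin_num_measure.
exists M; split; first by rewrite num_real.
by move=> y My w _ /=; rewrite (le_trans (fM w))// ltW.
Qed.

Lemma meanD f g : bmeas f -> bmeas g -> mean (fun w => f w + g w) = mean f + mean g.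
Proof. by move=> bf bg; apply: RintegralD => //; exact: bmeas_integrable. Qed.

Lemma meanZ c f : bmeas f -> mean (fun w => c * f w) = c * mean f.
Proof. by move=> bf; apply: RintegralZl => //; exact: bmeas_integrable. Qed.

Lemma mean_cst c : mean (fun=> c) = c.
Proof.
rewrite /mean Rintegral_cst//; transitivity (c * fine (1%E : \bar R)); last by rewrite mulr1.
by congr (_ * fine _); exact: probability_setT.
Qed.

Lemma mean_sum (I : Type) (s : seq I) (F : I -> T -> R) :
  (forall i, bmeas (F i)) -> mean (fun w => \sum_(i <- s) F i w) = \sum_(i <- s) mean (F i).
Proof.
move=> bF; elim: s => [|i s IH].
  by under [X in mean X]eq_fun do rewrite big_nil; rewrite mean_cst big_nil.
under [X in mean X]eq_fun do rewrite big_cons.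
by rewrite meanD ?IH ?big_cons//; exact: bmeas_sum.
Qed.

Lemma mean_le f g : bmeas f -> bmeas g -> (forall w, f w <= g w) -> mean f <= mean g.
Proof. by move=> bf bg fg; apply: le_Rintegral => // *; exact: bmeas_integrable. Qed.

Lemma mean_indic A : measurable A -> mean (\1_A) = fine (P A).
Proof. by move=> mA; rewrite /mean /Rintegral integral_indic// setIT. Qed.

Lemma meas_ge f r : measurable_fun setT f -> measurable [set w | r <= f w].
Proof.
move=> mf; rewrite (_ : [set _ | _] = setT `&` f @^-1` `[r, +oo[).
  by apply: mf => //; exact: measurable_itv.
by rewrite setTI; apply/seteqP; split => w /=; rewrite in_itv/= andbT.
Qed.

Lemma meas_gt f r : measurable_fun setT f -> measurable [set w | r < f w].
Proof.
move=> mf; rewrite (_ : [set _ | _] = setT `&` f @^-1` `]r, +oo[).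
  by apply: mf => //; exact: measurable_itv.
by rewrite setTI; apply/seteqP; split => w /=; rewrite in_itv/= andbT.
Qed.

Lemma bmeas_ge f r : bmeas f -> bmeas (\1_[set w | r <= f w] : T -> R).
Proof. by move=> [mf _]; apply/bmeas_indic/meas_ge. Qed.

(* The staircase [n^-1 * #{0 < k <= n | k/n <= Y}] is within [1/n] of [Y]. *)
Lemma mean_mul_indep Z Y c : bmeas Z -> bmeas Y -> (forall w, 0 <= Z w) ->
  (forall w, 0 <= Y w <= 1) ->
  (forall r, mean (fun w => Z w * \1_[set w | r <= Y w] w) =
             c * mean (\1_[set w | r <= Y w])) ->
  mean (fun w => Z w * Y w) = c * mean Y.
Proof.
move=> bZ bY Z0 Y01 ZY.
pose S n w : R := \sum_(k < n) n%:R^-1 * \1_[set w | k.+1%:R / n%:R <= Y w] w.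
have bS n : bmeas (S n).
  by apply: bmeas_sum => k; apply: bmeasM; [exact: bmeas_cst|exact: bmeas_ge].
have SE n : mean (fun w => Z w * S n w) = c * mean (S n).
  rewrite (_ : (fun w => Z w * S n w) = (fun w => \sum_(k < n) n%:R^-1 *
     (Z w * \1_[set w | k.+1%:R / n%:R <= Y w] w))); last first.
    by apply/funext => w; rewrite mulr_sumr; apply: eq_bigr => k _; ring.
  rewrite mean_sum; last first.
    move=> k; apply: bmeasM; first exact: bmeas_cst.
    by apply: bmeasM => //; exact: bmeas_ge.
  rewrite mean_sum; last first.
    by move=> k; apply: bmeasM; [exact: bmeas_cst|exact: bmeas_ge].
  rewrite mulr_sumr; apply: eq_bigr => k _.
  rewrite meanZ; last by apply: bmeasM => //; exact: bmeas_ge.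
  by rewrite ZY meanZ; [ring|exact: bmeas_ge].
have Sfloor n w : (0 < n)%N -> S n w = (Num.truncn (n%:R * Y w))%:R / n%:R.
  move=> n0; have n0' : 0 < n%:R :> R by rewrite ltr0n.
  have /andP[Y0 Y1] := Y01 w.
  have nY : 0 <= n%:R * Y w by rewrite mulr_ge0// ltW.
  rewrite /S -mulr_sumr mulrC; congr (_ * _).
  set m := Num.truncn _; have /andP[m1 m2] := truncn_itv nY; rewrite -/m in m1 m2.
  have mn : (m <= n)%N by rewrite -(ler_nat R) (le_trans m1)// ler_piMr// ltW.
  rewrite (eq_bigr (fun k : 'I_n => ((k < m)%N : nat)%:R)); last first.
    move=> k _; rewrite indicE; congr (nat_of_bool _)%:R; apply/idP/idP.
      rewrite inE /= ler_pdivrMr// [Y w * _]mulrC => h.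
      by have := le_lt_trans h m2; rewrite ltr_nat ltnS.
    move=> km; rewrite inE /= ler_pdivrMr// [Y w * _]mulrC; apply: le_trans m1.
    by rewrite ler_nat.
  rewrite -natr_sum; congr _%:R.
  rewrite -(big_mkord xpredT (fun k => nat_of_bool (k < m)%N)) (big_cat_nat _ mn)//=.
  rewrite [X in (_ + X)%N]big_nat_cond [X in (_ + X)%N]big1 ?addn0; last first.
    by move=> k /andP[/andP[mk _] _]; rewrite ltnNge mk.
  rewrite big_nat_cond (eq_bigr (fun _ => 1%N)); last first.
    by move=> k /andP[/andP[_ ->] _].
  by rewrite -big_nat_cond sum_nat_const_nat subn0 muln1.
have SY n w : (0 < n)%N -> S n w <= Y w <= S n w + n%:R^-1.
  move=> n0; have n0' : 0 < n%:R :> R by rewrite ltr0n.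
  have /andP[Y0 Y1] := Y01 w.
  have nY : 0 <= n%:R * Y w by rewrite mulr_ge0// ltW.
  have /andP[m1 m2] := truncn_itv nY.
  rewrite Sfloor// ler_pdivrMr// [Y w * _]mulrC m1/= -[X in _ + X]mul1r -mulrDl.
  by rewrite ler_pdivlMr// [Y w * _]mulrC ltW//; rewrite -natr1 in m2.
have mZ : mean Z = c.
  have one w : \1_[set w | 0 <= Y w] w = 1 :> R.
    by rewrite indicE mem_set//=; case/andP: (Y01 w).
  transitivity (mean (fun w => Z w * \1_[set w | 0 <= Y w] w)).
    by congr mean; apply/funext => w; rewrite one mulr1.
  rewrite ZY -[RHS]mulr1; congr (_ * _); rewrite -[RHS](mean_cst 1).
  by congr mean; apply/funext => w; rewrite one.
have c0 : 0 <= c by rewrite -mZ; apply: Rintegral_ge0.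
have bZY : bmeas (fun w => Z w * Y w) by exact: bmeasM.
have close n : (0 < n)%N -> `|mean (fun w => Z w * Y w) - c * mean Y| <= c * n%:R^-1.
  move=> n0.
  have h1 : mean (fun w => Z w * S n w) <= mean (fun w => Z w * Y w).
    apply: mean_le => //; first exact: bmeasM.
    by move=> w; rewrite ler_wpM2l//; case/andP: (SY n w n0).
  have bS1 : bmeas (fun w => S n w + n%:R^-1) by apply: bmeasD => //; exact: bmeas_cst.
  have h2 : mean (fun w => Z w * Y w) <= mean (fun w => Z w * S n w + n%:R^-1 * Z w).
    apply: mean_le => //.
      by apply: bmeasD; apply: bmeasM => //; exact: bmeas_cst.
    move=> w; rewrite [_ * Z w]mulrC -mulrDr ler_wpM2l//.
    by case/andP: (SY n w n0).
  rewrite meanD ?meanZ// in h2; last 2 first.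
  - exact: bmeasM.
  - by apply: bmeasM => //; exact: bmeas_cst.
  have h3 : mean (S n) <= mean Y.
    by apply: mean_le => // w; case/andP: (SY n w n0).
  have h4 : mean Y <= mean (fun w => S n w + n%:R^-1).
    by apply: mean_le => // w; case/andP: (SY n w n0).
  rewrite meanD ?mean_cst// in h4; last exact: bmeas_cst.
  rewrite SE mZ in h1 h2.
  have := ler_wpM2l c0 h3; have := ler_wpM2l c0 h4.
  rewrite ler_norml; move: h1 h2; rewrite [c * (_ + _)]mulrDr [_^-1 * c]mulrC; lra.
apply/eqP; rewrite -subr_eq0 -normr_eq0 eq_le normr_ge0 andbT.
apply/ler_addgt0Pr => e e0; rewrite add0r.
have [n nb] : exists n : nat, c / e < n%:R.
  by exists (Num.truncn (c / e)).+1; exact: truncnS_gt.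
have n0 : 0 < n%:R :> R by apply: le_lt_trans nb; rewrite divr_ge0// ltW.
apply: le_trans (close n _) _; first by rewrite -(ltr0n R).
by rewrite ler_pdivrMr// mulrC -ler_pdivrMr// ltW.
Qed.

Lemma mean_prod_indep (I : finType) (Y : I -> T -> R) (A : set T) :
  measurable A -> (forall i, measurable_fun setT (Y i)) ->
  (forall i w, 0 <= Y i w <= 1) ->
  (forall r : I -> R, P (A `&` \bigcap_i [set w | (r i <= Y i w)%R]) =
     (P A * \prod_i P [set w | (r i <= Y i w)%R])%E) ->
  mean (fun w => \1_A w * \prod_i Y i w) = fine (P A) * \prod_i mean (Y i).
Proof.
move=> mA mY Y01 ind.
have bY i : bmeas (Y i).
  split => //; exists 1 => w; have /andP[Y0 Y1] := Y01 i w; by rewrite ger0_norm.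
pose ind1 r i : T -> R := \1_[set w | r i <= Y i w].
have b1 r i : bmeas (ind1 r i) by exact: bmeas_ge.
(* Indicators are exchanged for the [Y i] one index at a time, [s] listing those already exchanged.
   The thresholds [r] stay quantified because the exchange at [k] uses the identity for every
   threshold at [k]. *)
pose V (s : seq I) r i : T -> R := if i \in s then Y i else ind1 r i.
have bV s r i : bmeas (V s r i) by rewrite /V; case: ifP.
have V0 s r i w : 0 <= V s r i w.
  by rewrite /V; case: ifP => _; [case/andP: (Y01 i w)|rewrite /ind1 indicE].
have mind : forall A, measurable A -> fine (P A) = mean (\1_A) by move=> *; rewrite mean_indic.
suff H s r : mean (fun w => \1_A w * \prod_i V s r i w) =
    fine (P A) * \prod_i mean (V s r i).
  have := H (enum I) (fun=> 0).
  rewrite (_ : (fun w => _) = fun w => \1_A w * \prod_i Y i w); last first.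
    apply/funext => w; congr (_ * _); apply: eq_bigr => i _.
    by rewrite /V mem_enum.
  by move=> ->; congr (_ * _); apply: eq_bigr => i _; rewrite /V mem_enum.
elim: s r => [|k s IH] r.
  rewrite (_ : (fun w => _) = \1_(A `&` \bigcap_i [set w | (r i <= Y i w)%R])); last first.
    apply/funext => w; rewrite indicI /=; congr (_ * _).
    rewrite /V /ind1 /= indicE; case: (boolP (w \in _)).
      rewrite inE => h; rewrite big1// => i _; rewrite indicE mem_set//; exact: h.
    move=> /negP h; have [i hi] : exists i, ~ (r i <= Y i w).
      by apply/existsNP => h'; apply: h; rewrite inE => i _; exact: h'.
    by rewrite (bigD1 i)//= indicE memNset ?mul0r.
  have mB : measurable (\bigcap_i [set w | (r i <= Y i w)%R]).
    by apply: fin_bigcap_measurable => // i _; exact: meas_ge.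
  rewrite mean_indic; last exact: measurableI.
  rewrite ind.
  have pE (J : seq I) : (\prod_(i <- J) P [set w | (r i <= Y i w)%R])%E =
      (\prod_(i <- J) mean (V [::] r i))%:E.
    elim: J => [|i J IHJ]; first by rewrite !big_nil.
    rewrite !big_cons IHJ EFinM; congr (_ * _)%E.
    rewrite /V /= /ind1 mean_indic ?fineK//; last exact: meas_ge.
    by rewrite fin_num_measure//; exact: meas_ge.
  by rewrite pE fineM// fin_num_measure.
have [ks|ks] := boolP (k \in s).
  have VE i : V (k :: s) r i = V s r i.
    by rewrite /V inE; case: eqP => // ->; rewrite ks.
  by under eq_bigr do rewrite VE; rewrite -IH; congr mean; apply/funext => w;
    congr (_ * _); apply: eq_bigr => i _; rewrite VE.
pose Z w := \1_A w * \prod_(i | i != k) V s r i w.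
have VE i : i != k -> V (k :: s) r i = V s r i by rewrite /V inE => /negPf ->.
have Vk : V (k :: s) r k = Y k by rewrite /V inE eqxx.
rewrite (_ : (fun w => _) = fun w => Z w * Y k w); last first.
  apply/funext => w; rewrite (bigD1 k)//= Vk /Z mulrCA mulrC; congr (_ * _ * _).
  by apply: eq_bigr => i ik; rewrite VE.
rewrite (mean_mul_indep (c := fine (P A) * \prod_(i | i != k) mean (V s r i)))//.
- rewrite [in RHS](bigD1 k)//= Vk -mulrA; congr (_ * _); rewrite mulrC; congr (_ * _).
  by apply: eq_bigr => i ik; rewrite VE.
- apply: bmeasM; first exact: bmeas_indic.
  under eq_fun do rewrite big_mkcond; apply: bmeas_prod => i.
  by case: (i != k) => //; exact: bmeas_cst.
- move=> w; apply: mulr_ge0; first by rewrite indicE.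
  by apply: prodr_ge0 => i _; exact: V0.
move=> t; pose r' i := if i == k then t else r i.
have V'E i : i != k -> V s r' i = V s r i.
  by move=> /negPf ik; rewrite /V /ind1 /r' ik.
have V'k : V s r' k = \1_[set w | t <= Y k w] by rewrite /V (negPf ks) /ind1 /r' eqxx.
have := IH r'; rewrite [in RHS](bigD1 k)//= V'k => h.
rewrite (_ : (fun w => _) = (fun w => \1_A w * \prod_i V s r' i w)); last first.
  apply/funext => w; rewrite [in RHS](bigD1 k)//= V'k /Z [RHS]mulrCA mulrC; congr (_ * (_ * _)).
  by apply: eq_bigr => i ik; rewrite V'E.
rewrite h [in RHS]mulrAC -mulrA; congr (_ * (_ * _)).
by apply: eq_bigr => i ik; rewrite V'E.
Qed.

End BoundedExpectation.

(** * Transport of functions of the configuration to the data *)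

Section Transfer.
Context {d : measure_display} {T : measurableType d} {R : realType}.
Variable P : probability T R.
Context {m1 m2 : nat}.
Variables (n : nat) (sigma U : R).
Variables (B : 'I_m1 -> 'I_m2 -> {RV P >-> bool}).
Variables (eps : 'I_m1 -> 'I_m2 -> {RV P >-> R}).
Hypothesis U0 : 0 < U.
Hypothesis nm : (n <= m1 * m2)%N.
Hypothesis HB : bernoulli_sampling n B eps.
Hypothesis Heps : noise_assumption sigma U eps.
Let E := ('I_m1 * 'I_m2)%type.
Let p : R := n%:R / (m1 * m2)%:R.
Let conf := {ffun E -> bool * bool}.

(** The noise is bounded by [U] only almost surely; clipping keeps the sign probabilities in [0, 1]
    at every point. *)
Definition clip (z : R) : R := Num.max (- U) (Num.min U z).

Definition vweight (s : bool) (z : R) : R := (1 + sgb s * (clip z / U)) / 2.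

Lemma clip_bound z : `|clip z| <= U.
Proof.
rewrite ler_norml /clip le_max lexx /= ge_max ge_min lexx /= andbT.
by rewrite (le_trans _ (ltW U0))// oppr_le0 ltW.
Qed.

Lemma clip_id z : `|z| <= U -> clip z = z.
Proof.
rewrite ler_norml /clip => /andP[h1 h2].
by rewrite min_r// max_r.
Qed.

Lemma vweight01 s z : 0 <= vweight s z <= 1.
Proof.
have /ler_normlP[h1 h2] := clip_bound z.
have a1 : clip z / U <= 1 by rewrite ler_pdivrMr// mul1r.
have a2 : - 1 <= clip z / U by rewrite ler_pdivlMr// mulN1r; lra.
by rewrite /vweight /sgb; case: s; lra.
Qed.

Definition agree (x : conf) : set T :=
  \bigcap_(e in setT) (B e.1 e.2 @^-1` [set (x e).1]).

(* Given the data at [w], draw for each entry a sign with conditional mean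
   [eps / U] : [cweight x w] is the probability of the configuration [x]. *)
Definition cweight (x : conf) (w : T) : R :=
  \1_(agree x) w * \prod_e vweight (x e).2 (eps e.1 e.2 w).

Definition sign_average (h : conf -> R) (w : T) : R := \sum_x cweight x w * h x.

Lemma meas_preB e b : measurable (B e.1 e.2 @^-1` [set b]).
Proof. by rewrite -[X in measurable X]setTI; exact: measurable_funP. Qed.

Lemma meas_agree x : measurable (agree x).
Proof. by apply: fin_bigcap_measurable => // e _; exact: meas_preB. Qed.

Lemma agreeE x w : \1_(agree x) w = \prod_e (B e.1 e.2 w == (x e).1)%:R :> R.
Proof.
rewrite indicE; case: (boolP (w \in _)) => [|/negP h].
  rewrite inE => h; rewrite big1// => e _.
  by have /= -> := h e I; rewrite eqxx.
have [e he] : exists e, ~ (B e.1 e.2 w = (x e).1).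
  by apply/existsNP => h'; apply: h; rewrite inE => e _; exact: h'.
by rewrite (bigD1 e)//= (introF eqP he) mul0r.
Qed.

Lemma cweightE x w : cweight x w =
  \prod_e ((B e.1 e.2 w == (x e).1)%:R * vweight (x e).2 (eps e.1 e.2 w)).
Proof. by rewrite /cweight agreeE [RHS]big_split. Qed.

Lemma cweight_ge0 x w : 0 <= cweight x w.
Proof.
rewrite cweightE; apply: prodr_ge0 => e _; rewrite mulr_ge0//.
by case/andP: (vweight01 (x e).2 (eps e.1 e.2 w)).
Qed.

Lemma sum_cweight1 (b : bool) z (f : bool * bool -> R) :
  \sum_v ((b == v.1)%:R * vweight v.2 z) * f v =
  (f (b, true) + f (b, false)) / 2 + clip z / U * ((f (b, true) - f (b, false)) / 2).
Proof. by rewrite sum_bool_pair /vweight /sgb /=; case: b => /=; field; rewrite gt_eqF. Qed.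

Lemma sum_cweight w (k : E) (f : bool * bool -> R) :
  \sum_x cweight x w * f (x k) =
  \sum_v ((B k.1 k.2 w == v.1)%:R * vweight v.2 (eps k.1 k.2 w)) * f v.
Proof.
transitivity (\sum_(x : conf) \prod_e
   (((B e.1 e.2 w == (x e).1)%:R * vweight (x e).2 (eps e.1 e.2 w)) *
    (if e == k then f (x e) else 1))).
  apply: eq_bigr => x _; rewrite cweightE [RHS]big_split/=; congr (_ * _).
  by rewrite (bigD1 k)//= eqxx big1 ?mulr1// => e /negPf ->.
rewrite -(bigA_distr_bigA (fun e v => ((B e.1 e.2 w == v.1)%:R * vweight v.2 (eps e.1 e.2 w)) *
    (if e == k then f v else 1)))/=.
rewrite (bigD1 k)//= eqxx [X in _ * X]big1 ?mulr1// => e /negPf ->.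
by rewrite (sum_cweight1 _ _ (fun=> 1)); field; rewrite gt_eqF.
Qed.

(** Jensen's inequality for a supremum: an expression linear in the signs averages exactly to the
    noise term, and [h] dominates all of them. As w is fixed, one value of [sign_average] serves all
    [a], [b], [c] at once. *)
Lemma sign_average_ge (h : conf -> R) (a b : E -> R) (c : R) w :
  (forall e, `|eps e.1 e.2 w| <= U) ->
  (forall x : conf, \sum_e (p - ((x e).1)%:R) * a e + c * \sum_e sparse_sign (x e) * b e <= h x) ->
  \sum_e (p - (B e.1 e.2 w)%:R) * a e +
    c / U * \sum_e (B e.1 e.2 w)%:R * eps e.1 e.2 w * b e <= sign_average h w.
Proof.
move=> we H.
apply: (@le_trans _ _ (\sum_x cweight x w *
   (\sum_e (p - ((x e).1)%:R) * a e + c * \sum_e sparse_sign (x e) * b e))); last first.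
  by apply: ler_sum => x _; rewrite ler_wpM2l ?cweight_ge0.
rewrite le_eqVlt; apply/orP; left; apply/eqP.
under [RHS]eq_bigr do rewrite mulrDr.
rewrite big_split/=; congr (_ + _).
  under [RHS]eq_bigr do rewrite mulr_sumr.
  rewrite exchange_big/=; apply: eq_bigr => e _.
  rewrite (sum_cweight w e (fun v => (p - (v.1)%:R) * a e)) sum_cweight1 /=.
  by field; rewrite gt_eqF.
under [RHS]eq_bigr do rewrite mulrCA mulr_sumr.
rewrite -mulr_sumr exchange_big/= -mulrA; congr (_ * _).
rewrite mulr_sumr; apply: eq_bigr => e _.
rewrite (sum_cweight w e (fun v => sparse_sign v * b e)) sum_cweight1 /= clip_id//.
by rewrite /sparse_sign /sgb /=; case: (B _ _ w) => /=; field; rewrite gt_eqF.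
Qed.

Hypothesis m12 : (0 < m1 * m2)%N.

Lemma p01 : 0 <= p <= 1.
Proof.
by rewrite divr_ge0 ?ler0n//= ler_pdivrMr ?ltr0n// mul1r ler_nat.
Qed.

Lemma bmeas_clip e : bmeas (fun w => clip (eps e.1 e.2 w)).
Proof.
split; last by exists U => w; exact: clip_bound.
by apply: measurable_maxr => //; apply: measurable_minr => //; exact: measurable_funP.
Qed.

Lemma mean_clip e : mean P (fun w => clip (eps e.1 e.2 w)) = 0.
Proof.
have := noise_mean Heps e.1 e.2; rewrite unlock => h.
rewrite /mean /Rintegral (_ : integral _ _ _ = 0%E)// -h.
apply: ae_eq_integral => //.
- exact/measurable_EFinP/(proj1 (bmeas_clip e)).
- exact/measurable_EFinP/measurable_funP.
have := noise_bounded Heps; apply: filterS => w /= /(_ e.1 e.2) hw _.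
by rewrite clip_id.
Qed.

Lemma mean_vweight s e : mean P (fun w => vweight s (eps e.1 e.2 w)) = 2^-1.
Proof.
rewrite (_ : (fun w => _) = fun w => 2^-1 + (sgb s / U / 2) * clip (eps e.1 e.2 w)).
  rewrite meanD ?mean_cst ?meanZ ?mean_clip ?mulr0 ?addr0//.
  - exact: bmeas_clip.
  - exact: bmeas_cst.
  - by apply: bmeasM; [exact: bmeas_cst|exact: bmeas_clip].
by apply/funext => w; rewrite /vweight; field; rewrite gt_eqF.
Qed.

Lemma prob_preB e b : P (B e.1 e.2 @^-1` [set b]) = (if b then p else 1 - p)%:E.
Proof.
have := sampling_law HB e.1 e.2; move=> /(_ [set b]).
rewrite /distribution /pushforward /bernoulli_prob -/p p01 => ->.
by rewrite fsbig_set1.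
Qed.

Lemma prob_agree x : P (agree x) = (\prod_e (if (x e).1 then p else 1 - p))%:E.
Proof.
have := sampling_indep HB (J := [set: E]%SET) (A := fun e => B e.1 e.2 @^-1` [set (x e).1]).
have -> : [set` [set: E]%SET] = setT by apply/seteqP; split => e //= _; rewrite !inE.
rewrite -/(agree x) => ->; last first.
  by move=> e _; exists [set (x e).1] => //; rewrite setTI.
rewrite (eq_bigr (fun e => (if (x e).1 then p else 1 - p)%:E)); last by move=> e _; exact: prob_preB.
by rewrite prodEFin; congr EFin; apply: eq_bigl => e; rewrite inE.
Qed.

Lemma meas_vweight s e : measurable_fun setT (fun w => vweight s (eps e.1 e.2 w)).
Proof.
apply: measurable_funM => //; apply: measurable_funD => //.
apply: measurable_funM => //; apply: measurable_funM => //.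
exact: (proj1 (bmeas_clip e)).
Qed.

Lemma bmeas_cweight x : bmeas (cweight x).
Proof.
apply: bmeasM; first exact/bmeas_indic/meas_agree.
apply: bmeas_prod => e; split; first exact: meas_vweight.
exists 1 => w; have /andP[v0 v1] := vweight01 (x e).2 (eps e.1 e.2 w).
by rewrite ger0_norm.
Qed.

Lemma bmeas_sign_average h : bmeas (sign_average h).
Proof.
by apply: bmeas_sum => x; apply: bmeasM; [exact: bmeas_cweight|exact: bmeas_cst].
Qed.

Lemma sign_average_ge0 h w : (forall x, 0 <= h x) -> 0 <= sign_average h w.
Proof. by move=> h0; apply: sumr_ge0 => x _; rewrite mulr_ge0 ?cweight_ge0. Qed.

(** Biased given the noise, the signs are fair on average because the noise is centered; with the
    independence assumptions the pairs (indicator, sign) then have exactly the product law. *)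
Lemma sign_average_mean h : mean P (sign_average h) = pexp (sign_law p) h.
Proof.
have bc := bmeas_cweight; have mv := meas_vweight.
rewrite /sign_average mean_sum; last by move=> x; apply: bmeasM => //; exact: bmeas_cst.
apply: eq_bigr => x _.
under [X in mean _ X]eq_fun do rewrite mulrC.
rewrite meanZ// mulrC; congr (_ * _).
rewrite /cweight mean_prod_indep//.
- rewrite prob_agree /=; under [X in _ * X]eq_bigr do rewrite mean_vweight.
  by rewrite -big_split.
- exact: meas_agree.
- by move=> e w; exact: vweight01.
move=> r; set A := \bigcap_i _.
have pre e : [set w | (r e <= vweight (x e).2 (eps e.1 e.2 w))%R] =
    eps e.1 e.2 @^-1` [set z | r e <= vweight (x e).2 z] by [].
have mpre e : measurable [set z : R | r e <= vweight (x e).2 z].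
  apply: meas_ge; apply: measurable_funM => //; apply: measurable_funD => //.
  apply: measurable_funM => //; apply: measurable_funM => //.
  by apply: measurable_maxr => //; apply: measurable_minr.
have sg1 e : sigma_of (eps e.1 e.2) [set w | (r e <= vweight (x e).2 (eps e.1 e.2 w))%R].
  by exists [set z : R | r e <= vweight (x e).2 z] => //; rewrite setTI.
rewrite (sampling_noise_indep HB).
- congr (_ * _)%E.
  have := noise_indep Heps (J := [set: E]%SET)
     (A := fun e => [set w | (r e <= vweight (x e).2 (eps e.1 e.2 w))%R]).
  have -> : [set` [set: E]%SET] = setT by apply/seteqP; split => e //= _; rewrite !inE.
  rewrite -/A => ->; last by move=> e _.
  by apply: eq_bigl => e; rewrite inE.
- rewrite /sigma_of_family.
  apply: (@fin_bigcap_measurable _ (g_sigma_algebraType (\bigcup_i sigma_of (B i.1 i.2)))) => //.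
  move=> e _; apply: sub_gen_smallest; exists e => //.
  by exists [set (x e).1] => //; rewrite setTI.
- rewrite /sigma_of_family.
  apply: (@fin_bigcap_measurable _ (g_sigma_algebraType (\bigcup_i sigma_of (eps i.1 i.2)))) => //.
  by move=> e _; apply: sub_gen_smallest; exists e.
Qed.

End Transfer.

(** * The uniform deviation bound *)

Section Discrete.
Context {R : realType}.

(** The second moment is p |D|_F^2, the cross terms being centered; |z| <= z^2 / (2c) + c / 2 turns
    it into a first moment. *)
Lemma pexp_mxdot_abs (p : R) m n (D : 'M[R]_(m, n)) : 0 < p <= 1 ->
  pexp (sign_law p) (fun x => `|mxdot (sign_mx x) D|) <= Num.sqrt p * frob_norm D.
Proof.
move=> /andP[p0 p1]; have p01 : 0 <= p <= 1 by rewrite ltW.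
have mu0 := sign_law_ge0 p01.
set c := Num.sqrt p * frob_norm D.
have c0 : 0 <= c by rewrite mulr_ge0 ?sqrtr_ge0 ?frob_norm_ge0.
have c2 : c ^+ 2 = p * mxdot D D by rewrite exprMn sqr_sqrtr ?frob_normE// ltW.
have sqnormE : pexp (sign_law p) (fun x => mxdot (@sign_mx R m n x) D ^+ 2) = c ^+ 2.
  rewrite c2 /mxdot.
  transitivity (pexp (sign_law p) (fun x => \sum_(e : 'I_m * 'I_n) \sum_(f : 'I_m * 'I_n)
      (D e.1 e.2 * D f.1 f.2) * \prod_(g <- [:: e; f]) sparse_sign (x g))).
    apply: eq_pexp => x; rewrite expr2 mulr_suml; apply: eq_bigr => -[e1 e2] _.
    rewrite mulr_sumr; apply: eq_bigr => -[f1 f2] _.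
    by rewrite !big_cons big_nil !mxE /=; ring.
  rewrite pexp_sum mulr_sumr; apply: eq_bigr => e _; rewrite pexp_sum (bigD1 e)//= big1 ?addr0.
    by rewrite pexpZ pexp_sparse_sign /= inE eqxx /even_mult /= eqxx /= mul1r expr1; ring.
  move=> f fe; rewrite pexpZ pexp_sparse_sign (_ : even_mult _ = false) ?mul0r ?mulr0//.
  by rewrite /even_mult /= eqxx (negPf fe).
have [cz|cN] := eqVneq c 0.
  rewrite cz; have /eqP D0 : frob_norm D == 0.
    by move/eqP: cz; rewrite mulf_eq0 gt_eqF ?sqrtr_gt0.
  have D00 e : D e.1 e.2 = 0.
    have : mxdot D D = 0 by rewrite -frob_normE D0 expr0n.
    move/eqP; rewrite psumr_eq0 => [/allP/(_ e)|f _]; last by rewrite -expr2 sqr_ge0.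
    by rewrite mem_index_enum => /(_ isT); rewrite mulf_eq0 orbb => /eqP.
  rewrite (@eq_pexp _ _ _ _ _ (fun=> 0)); first by rewrite pexp_cst//; exact: sign_law_sum1.
  by move=> x; rewrite /mxdot big1 ?normr0// => e _; rewrite D00 mulr0.
have cp : 0 < c by rewrite lt_neqAle eq_sym cN.
apply: (@le_trans _ _ (pexp (sign_law p) (fun x => (2 * c)^-1 * mxdot (sign_mx x) D ^+ 2 + c / 2))).
  apply: (pexp_le mu0) => x.
  set y := mxdot _ _; rewrite -[y ^+ 2]real_normK ?num_real//; move: `|y| => z.
  rewrite -subr_ge0 (_ : _ - _ = (2 * c)^-1 * (z - c) ^+ 2); last by field; rewrite gt_eqF.
  by rewrite mulr_ge0 ?sqr_ge0// invr_ge0 mulr_ge0.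
rewrite pexpD pexpZ pexp_cst; last exact: sign_law_sum1.
by rewrite sqnormE le_eqVlt; apply/orP; left; apply/eqP; field.
Qed.

Lemma mxdotD m n (X D D' : 'M[R]_(m, n)) : mxdot X (D + D') = mxdot X D + mxdot X D'.
Proof. by rewrite /mxdot -big_split; apply: eq_bigr => e _ /=; rewrite mxE mulrDr. Qed.

Lemma mxdotN m n (X D : 'M[R]_(m, n)) : mxdot X (- D) = - mxdot X D.
Proof. by rewrite /mxdot -sumrN; apply: eq_bigr => e _ /=; rewrite mxE mulrN. Qed.

Lemma frob_normB_le m n (X Y : 'M[R]_(m, n)) :
  frob_norm (X - Y) ^+ 2 <= 2 * frob_norm X ^+ 2 + 2 * frob_norm Y ^+ 2.
Proof.
rewrite !frob_normE /mxdot !mulr_sumr -big_split; apply: ler_sum => e _ /=.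
rewrite !mxE; set x := X _ _; set y := Y _ _.
rewrite -subr_ge0 (_ : _ - _ = (x + y) ^+ 2); last by ring.
exact: sqr_ge0.
Qed.

Lemma calA_entry m n (a : R) k (A : 'M[R]_(m, n)) i j : calA a k A -> `|A i j| <= a.
Proof.
move=> [Aa _]; apply: le_trans Aa; rewrite mx_normrE.
exact: (le_bigmax _ (fun ij : 'I_m * 'I_n => `|A ij.1 ij.2|) (i, j)).
Qed.

Lemma rankB m n (A A' : 'M[R]_(m, n)) k :
  (\rank A <= k)%N -> (\rank A' <= k)%N -> (\rank (A - A')%R <= 2 * k)%N.
Proof.
move=> rA rA'; apply: leq_trans (mxrank_add _ _) _.
by rewrite mxrank_opp mul2n -addnn leq_add.
Qed.

(* [h] dominates the normalized deviation process, uniformly over the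
   candidates [A]; the star-shaped normalization replaces peeling. *)
Lemma discrete_bound (p a U delta : R) m1 m2 k k0 t (M : 'M[R]_(m1.+1, m2.+1)) :
  let q := (2 ^ t)%N in
  let L := Num.sqrt (2 ^+ 118 * q%:R) : R in
  0 < p -> p <= 1 -> p * m1.+1%:R <= q%:R -> p * m2.+1%:R <= q%:R ->
  p^-1 <= 4 ^+ q -> 0 < a -> 0 < U -> 0 < delta ->
  calA a k M -> frob_dist M (calA a k0) = delta ->
  exists h : {ffun 'I_m1.+1 * 'I_m2.+1 -> bool * bool} -> R,
  [/\ forall x, 0 <= h x,
     forall A (c : R) (x : {ffun 'I_m1.+1 * 'I_m2.+1 -> bool * bool}),
     calA a k0 A -> `|c| <= 2 * U / delta ->
       \sum_e (p - ((x e).1)%:R) * ((M - A) e.1 e.2 / frob_norm (M - A)) ^+ 2 +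
       c * \sum_e sparse_sign (x e) * ((M - A) e.1 e.2 / frob_norm (M - A)) <= h x &
     pexp (sign_law p) h <= (8 * a + 2 * U) / delta *
       (2 * Num.sqrt p + 8 * Num.sqrt (2 * k0)%:R * L)].
Proof.
move=> q L p0 p1 pm1 pm2 pq a0 U0 d0 MA dE.
have [g [g0 gb Eg]] := @spectral_bound R p m1 m2 t p0 p1 pm1 pm2 pq.
have p01 : 0 <= p <= 1 by rewrite p1 ltW.
have mu0 := sign_law_ge0 p01.
pose fd := [set frob_norm (M - A) | A in calA a k0].
have fd0 : lbound fd 0 by move=> _ [A _ <-]; exact: frob_norm_ge0.
have fdn : fd !=set0.
  exists (frob_norm (M - 0)); exists 0 => //; split; last by rewrite mxrank0.
  by rewrite mx_norm0 ltW.
have dle A : calA a k0 A -> delta <= frob_norm (M - A).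
  by move=> Ak; rewrite -dE; apply: ge_inf; [exists 0|exists A].
(* A matrix within a factor 2 of the infimum is enough, so attainment is not at issue. *)
have [A0 A0k A0d] : exists2 A0, calA a k0 A0 & frob_norm (M - A0) <= 2 * delta.
  have [_ [A Ak <-] Ad] := inf_adherent d0 (conj fdn (ex_intro _ 0 fd0)).
  exists A => //; apply: ltW; apply: lt_le_trans Ad _.
  by rewrite -/(frob_dist _ _) dE; lra.
set D0 := M - A0 in A0d.
pose nrm A := frob_norm (M - A).
pose tv A (e : 'I_m1.+1 * 'I_m2.+1) := (M - A) e.1 e.2 / nrm A.
have nrm0 A : calA a k0 A -> 0 < nrm A by move=> /dle; exact: lt_le_trans.
pose h2 (x : {ffun 'I_m1.+1 * 'I_m2.+1 -> bool * bool}) := `|mxdot (sign_mx x) D0| / delta + g x * (4 * Num.sqrt (2 * k0)%:R).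
have h20 x : 0 <= h2 x by rewrite addr_ge0 ?divr_ge0 ?mulr_ge0 ?sqrtr_ge0// ltW.
have ipt (x : {ffun 'I_m1.+1 * 'I_m2.+1 -> bool * bool}) A : \sum_e sparse_sign (x e) * tv A e = mxdot (sign_mx x) (M - A) / nrm A.
  rewrite /mxdot mulr_suml; apply: eq_bigr => -[i j] _.
  by rewrite /tv [sign_mx _ _ _]mxE mulrA.
have h2b (x : {ffun 'I_m1.+1 * 'I_m2.+1 -> bool * bool}) A : calA a k0 A -> `|\sum_e sparse_sign (x e) * tv A e| <= h2 x.
  move=> Ak; have nA := nrm0 _ Ak; have dA := dle _ Ak.
  have lr (H : 'M[R]_(m1.+1, m2.+1)) : (\rank H <= 2 * k0)%N ->
      mxdot (sign_mx x) H <= g x * Num.sqrt (2 * k0)%:R * frob_norm H.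
    move=> rH; have h := @mxdot_low_rank R _ _ (sign_mx x) H (g x) (g0 x)(gb x).
    apply: le_trans h _.
    rewrite ler_wpM2r ?frob_norm_ge0// ler_wpM2l// ler_sqrt ?ler0n//.
    by rewrite ler_nat.
  have rk : (\rank (A0 - A)%R <= 2 * k0)%N by apply: rankB; [case: A0k|case: Ak].
  have rk' : (\rank (- (A0 - A))%R <= 2 * k0)%N by rewrite mxrank_opp.
  have fN : frob_norm (- (A0 - A)) = frob_norm (A0 - A).
    by apply/eqP; rewrite -(eqrXn2 (n := 2)) ?frob_norm_ge0// !frob_normE /mxdot;
       apply/eqP; apply: eq_bigr => e _; rewrite mxE mulrNN.
  (* With delta <= |M - A|, the squared norm is at most (2 + 2 * 4) |M - A|^2, and 10 <= 16. *)
  have f4 : frob_norm (A0 - A) <= 4 * nrm A.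
    rewrite -ler_sqr ?nnegrE ?frob_norm_ge0 ?mulr_ge0 ?(ltW nA)//.
    have -> : A0 - A = (M - A) - D0 by apply/matrixP => i j; rewrite !mxE; ring.
    apply: le_trans (frob_normB_le _ _) _; rewrite -/(nrm A) exprMn.
    have : frob_norm D0 ^+ 2 <= (2 * nrm A) ^+ 2.
      rewrite lerXn2r ?nnegrE ?frob_norm_ge0 ?mulr_ge0 ?(ltW nA)//.
      by apply: le_trans A0d _; rewrite ler_wpM2l.
    rewrite exprMn; have := sqr_ge0 (nrm A); lra.
  have b1 : `|mxdot (sign_mx x) (A0 - A)| <= g x * Num.sqrt (2 * k0)%:R * (4 * nrm A).
    apply: (@le_trans _ _ (g x * Num.sqrt (2 * k0)%:R * frob_norm (A0 - A))).
      rewrite ler_norml lerNl -mxdotN -{1}fN !lr//.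
    by rewrite ler_wpM2l// mulr_ge0 ?sqrtr_ge0.
  rewrite ipt (_ : M - A = D0 + (A0 - A)); last by rewrite /D0 addrA subrK.
  rewrite normrM normfV (gtr0_norm nA) ler_pdivrMr// mxdotD.
  apply: le_trans (ler_normD _ _) _; rewrite mulrDl; apply: lerD.
    rewrite -[leLHS]mulr1 -mulrA ler_wpM2l// mulrC ler_pdivlMr// mul1r//.
  by apply: le_trans b1 _; rewrite le_eqVlt; apply/orP; left; apply/eqP; ring.
(* Adding the zero function makes the supremum nonnegative, as Markov's inequality requires. *)
pose T := [set s | s = (fun=> 0) \/ exists2 A, calA a k0 A & s = tv A] : set ('I_m1.+1 * 'I_m2.+1 -> R).
have T0 : T (fun=> 0) by left.
have Tn : T !=set0 by exists (fun=> 0).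
pose kappa := 2 * a / delta.
have kappa0 : 0 <= kappa by rewrite divr_ge0 ?mulr_ge0// ltW.
have k40 : 0 <= 4 * kappa by exact: mulr_ge0.
have Tk s : T s -> forall e, `|s e| <= kappa.
  move=> [->|[A Ak ->]] e; first by rewrite normr0.
  have nA := nrm0 _ Ak.
  rewrite /tv normrM normfV (gtr0_norm nA) /kappa ler_pM ?invr_ge0 ?(ltW nA)//.
    rewrite !mxE; apply: le_trans (ler_normB _ _) _.
    have := calA_entry e.1 e.2 MA; have := calA_entry e.1 e.2 Ak; lra.
  by rewrite lef_pV2 ?posrE// dle.
pose H1 (x : {ffun 'I_m1.+1 * 'I_m2.+1 -> bool * bool}) := supT T (fun s => \sum_e (p - ((x e).1)%:R) * s e ^+ 2).
have H1b (x : {ffun 'I_m1.+1 * 'I_m2.+1 -> bool * bool}) : bddT T (fun s => \sum_e (p - ((x e).1)%:R) * s e ^+ 2).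
  by apply: bdd_sum => e; apply: bdd_sqr; [exact: Tn|exact: Tk].
have H10 x : 0 <= H1 x.
  apply: le_trans (supT_ge (H1b x) T0); rewrite big1// => e _.
  by rewrite expr0n mulr0.
exists (fun x => H1 x + 2 * U / delta * h2 x); split.
- by move=> x; rewrite addr_ge0// mulr_ge0// divr_ge0// ?mulr_ge0// ltW.
- move=> A c x Ak cU; apply: lerD.
    by apply: (supT_ge (H1b x)); right; exists A.
  apply: le_trans (ler_norm _) _; rewrite normrM ler_pM//; exact: h2b.
rewrite pexpD pexpZ.
(* After contraction the quadratic part is dominated by the same [h2] as the noise part. *)
have EH1 : pexp (sign_law p) H1 <= 4 * kappa * pexp (sign_law p) h2.
  have C := square_contraction p01 Tn Tk; apply: le_trans C _; rewrite -pexpZ.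
  apply: (pexp_le mu0) => x; apply: supT_le => // s [->|[A Ak ->]].
    rewrite big1 ?mulr0; first exact: mulr_ge0.
    by move=> e _; rewrite mulr0.
  apply: ler_wpM2l => //; apply: le_trans (ler_norm _) _; exact: h2b.
have Eh2 : pexp (sign_law p) h2 <= 2 * Num.sqrt p + 8 * Num.sqrt (2 * k0)%:R * L.
  rewrite /h2 pexpD; apply: lerD.
    rewrite (_ : pexp _ _ = delta^-1 * pexp (sign_law p) (fun x => `|mxdot (sign_mx x) D0|)); last first.
      by rewrite -pexpZ; apply: eq_pexp => x; rewrite mulrC.
    rewrite ler_pdivrMl//; apply: le_trans (pexp_mxdot_abs _ _) _; first by rewrite p0.
    have := ler_wpM2l (sqrtr_ge0 p) A0d; lra.
  rewrite (_ : pexp _ _ = (4 * Num.sqrt (2 * k0)%:R) * pexp (sign_law p) g); last first.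
    by rewrite -pexpZ; apply: eq_pexp => x; rewrite mulrC.
  have := ler_wpM2l (_ : 0 <= 4 * Num.sqrt (2 * k0)%:R) Eg.
  move=> /(_ _)/le_trans; apply; first by rewrite mulr_ge0 ?sqrtr_ge0.
  by rewrite le_eqVlt; apply/orP; left; apply/eqP; rewrite /L /q; ring.
apply: (@le_trans _ _ ((4 * kappa + 2 * U / delta) * pexp (sign_law p) h2)).
  by rewrite [leRHS]mulrDl; apply: lerD.
rewrite (_ : 4 * kappa + 2 * U / delta = (8 * a + 2 * U) / delta); last first.
  by rewrite /kappa; field; rewrite gt_eqF.
by rewrite ler_wpM2l// divr_ge0 ?addr_ge0 ?mulr_ge0// ltW.
Qed.

End Discrete.

Section FinalLemmas.
Context {d : measure_display} {T : measurableType d} {R : realType}.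
Variable P : probability T R.

(* [f] need not be measurable: the integral of a nonnegative function is the
   supremum of the integrals of the simple functions below it. *)
Lemma expectation_le_prob (f : T -> R) (A : set T) : measurable A ->
  (forall w, 0 <= f w <= \1_A w) -> fine ('E_P[f])%E <= fine (P A).
Proof.
move=> mA fA.
have f0 w : (0 <= (f w)%:E)%E by rewrite lee_fin; case/andP: (fA w).
have h : ('E_P[f] <= P A)%E.
  have -> : P A = (\int[P]_w (\1_A w)%:E)%E by rewrite integral_indic// setIT.
  rewrite unlock !ge0_integralTE//.
  by apply: le_ereal_sup => _ [h hf <-]; exists h => // w;
      rewrite (le_trans (hf w))// lee_fin; case/andP: (fA w).
apply: fine_le => //; last by rewrite fin_num_measure.
rewrite ge0_fin_numE; first by apply: le_lt_trans h _; rewrite -ge0_fin_numE// fin_num_measure.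
by rewrite unlock; apply: integral_ge0.
Qed.

Lemma markov_mean (X : T -> R) (c : R) : 0 < c -> bmeas X -> (forall w, 0 <= X w) ->
  fine (P [set w | c <= X w]) <= mean P X / c.
Proof.
move=> c0 bX X0.
have mA : measurable [set w | c <= X w] by apply: meas_ge; case: bX.
rewrite ler_pdivlMr// mulrC -mean_indic// -meanZ//; last exact: bmeas_indic.
apply: mean_le => //; first by apply: bmeasM; [exact: bmeas_cst|exact: bmeas_indic].
move=> w; rewrite indicE; case: (boolP (w \in _)) => [|_]; last by rewrite mulr0.
by rewrite inE /= mulr1.
Qed.

End FinalLemmas.

(** * Choice of the moment order *)

Section Numeric.
Context {R : realType}.

Lemma pow2_between (y : R) : 1 <= y ->
  exists t, y <= (2 ^ t)%:R <= 2 * y.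
Proof.
move=> y1; have ex : exists t, y <= (2 ^ t)%:R.
  exists (Num.truncn y).+1; apply: ltW; apply: (lt_trans (truncnS_gt y)).
  by rewrite ltr_nat ltn_expl.
case: (ex_minnP ex) => t yt tmin; exists t; rewrite yt /=.
case: t yt tmin => [|t] yt tmin; first by rewrite expn0; lra.
rewrite expnS natrM ler_wpM2l// ltW// ltNge; apply/negP => /tmin.
by rewrite ltnn.
Qed.

Lemma expR1_le4 : expR 1 <= 4 :> R.
Proof. by have := @expR_le_quad R 1; rewrite normr1 lexx => /(_ isT); lra. Qed.

(** With N the larger dimension, n >= m log d says p N >= log d. Let q be a power of two between p N
    and 2 p N; then 1 / p <= N <= d <= exp q <= 4^q. Since d >= 4 > e, also p N >= 1, so q
    exists. *)
Lemma sampling_numeric (m1 m2 n : nat) : (2 <= minn m1 m2)%N -> (n <= m1 * m2)%N ->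
  (minn m1 m2)%:R * ln ((m1 + m2)%:R : R) <= n%:R ->
  let p : R := n%:R / (m1 * m2)%:R in
  [/\ 0 < p, p <= 1 & exists t, [/\ p * m1%:R <= (2 ^ t)%:R, p * m2%:R <= (2 ^ t)%:R,
    p^-1 <= 4 ^+ (2 ^ t) & (2 ^ t)%:R <= 2 * (p * (m1 + m2)%:R)] ].
Proof.
move=> m2' nm hn p.
set m := minn m1 m2 in m2' hn *; pose N := maxn m1 m2.
have mN : (m * N = m1 * m2)%N by rewrite /m /N /minn /maxn; case: ltnP => _ //; rewrite mulnC.
have m0 : 0 < m%:R :> R by rewrite ltr0n; lia.
have N0 : 0 < N%:R :> R by rewrite ltr0n /N; lia.
have mm0 : 0 < (m1 * m2)%:R :> R by rewrite -mN natrM mulr_gt0.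
have d4 : (4 <= m1 + m2)%N by rewrite /m in m2'; lia.
have NN : (N <= m1 + m2)%N by rewrite geq_max leq_addr leq_addl.
have d0 : 0 < (m1 + m2)%:R :> R by rewrite ltr0n; lia.
have ln1 : 1 <= ln ((m1 + m2)%:R : R).
  rewrite -{1}(expRK (1 : R)) ler_ln ?posrE ?expR_gt0//.
  have h : (4%:R : R) <= (m1 + m2)%:R by rewrite ler_nat.
  exact: le_trans expR1_le4 h.
have pN : p * N%:R = n%:R / m%:R.
  by rewrite /p -mN natrM; field; rewrite !gt_eqF.
have lnpN : ln ((m1 + m2)%:R : R) <= p * N%:R by rewrite pN ler_pdivlMr// mulrC.
have pN1 : 1 <= p * N%:R by exact: le_trans lnpN.
have p0 : 0 < p by rewrite -(pmulr_lgt0 _ N0); apply: lt_le_trans pN1.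
have p1 : p <= 1 by rewrite ler_pdivrMr// mul1r ler_nat.
split => //; have [t /andP[t1 t2]] := pow2_between pN1; exists t.
have leN k : (k <= N)%N -> p * k%:R <= (2 ^ t)%:R.
  by move=> kN; apply: le_trans t1; rewrite ler_wpM2l ?(ltW p0)// ler_nat.
split; [by apply: leN; rewrite leq_maxl|by apply: leN; rewrite leq_maxr| |].
  apply: (@le_trans _ _ (m1 + m2)%:R).
    rewrite -[leLHS]mul1r ler_pdivrMr//; apply: le_trans pN1 _.
    by rewrite mulrC ler_wpM2r ?(ltW p0)// ler_nat.
  rewrite -[leLHS](@lnK R) ?posrE//.
  apply: (@le_trans _ _ (expR (2 ^ t)%:R)); first by rewrite ler_expR (le_trans lnpN).
  rewrite -[X in expR X]mulr1 expRM_natl.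
  by rewrite lerXn2r ?nnegrE ?expR_ge0// expR1_le4.
by apply: le_trans t2 _; rewrite ler_wpM2l// ler_wpM2l ?(ltW p0)// ler_nat.
Qed.

End Numeric.

(** * Risks of the test *)

Section Risks.
Context {R : realType} {m1 m2 : nat}.
Context {d : measure_display} {T : measurableType d}.
Variable P : probability T R.
Variables (n : nat) (sigma a U : R) (k0 : nat).
Variables (B : 'I_m1 -> 'I_m2 -> {RV P >-> bool}).
Variables (eps : 'I_m1 -> 'I_m2 -> {RV P >-> R}).
Hypothesis a0 : 0 < a.
Hypothesis Heps : noise_assumption sigma U eps.

Lemma calA0 : calA a k0 (0 : 'M[R]_(m1, m2)).
Proof. by split; [rewrite mx_norm0 ltW|rewrite mxrank0]. Qed.

Lemma noise_statE w : noise_stat B eps n w =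
  `|(Num.sqrt (2 * n%:R))^-1 *
     \sum_(e : 'I_m1 * 'I_m2) (B e.1 e.2 w)%:R * (eps e.1 e.2 w ^+ 2 - sigma ^+ 2)|.
Proof.
rewrite /noise_stat normrM ger0_norm ?invr_ge0 ?sqrtr_ge0//; congr (_ * `|_|).
rewrite pair_big/=; apply: eq_bigr => e _; by rewrite (noise_variance Heps).
Qed.

Lemma residualE (M A : 'M[R]_(m1, m2)) w :
  \sum_i \sum_j (B i j w)%:R * ((obs B eps M i j w - A i j) ^+ 2 - sigma ^+ 2) =
  \sum_(e : 'I_m1 * 'I_m2) (B e.1 e.2 w)%:R * (M - A) e.1 e.2 ^+ 2 +
  2 * \sum_(e : 'I_m1 * 'I_m2) (B e.1 e.2 w)%:R * eps e.1 e.2 w * (M - A) e.1 e.2 +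
  \sum_(e : 'I_m1 * 'I_m2) (B e.1 e.2 w)%:R * (eps e.1 e.2 w ^+ 2 - sigma ^+ 2).
Proof.
rewrite pair_big/= mulr_sumr -!big_split; apply: eq_bigr => e _ /=.
by rewrite /obs !mxE; case: (B _ _ w) => /=; ring.
Qed.

Lemma test_stat_null (M : 'M[R]_(m1, m2)) w : calA a k0 M ->
  test_stat B eps n sigma a k0 M w <= noise_stat B eps n w.
Proof.
move=> MA; apply: ge_inf; first by exists 0 => _ [A _ <-].
exists M => //; rewrite residualE noise_statE subrr; congr (`|_ * _|).
rewrite [X in X + _ + _]big1; last by move=> e _; rewrite mxE expr0n mulr0.
by rewrite [X in 2 * X]big1 ?mulr0 ?add0r// => e _; rewrite mxE mulr0.
Qed.

Lemma test_stat_ge (M : 'M[R]_(m1, m2)) w (c : R) :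
  (forall A, calA a k0 A -> c <= \sum_(e : 'I_m1 * 'I_m2) (B e.1 e.2 w)%:R * (M - A) e.1 e.2 ^+ 2 +
    2 * \sum_(e : 'I_m1 * 'I_m2) (B e.1 e.2 w)%:R * eps e.1 e.2 w * (M - A) e.1 e.2) ->
  (Num.sqrt (2 * n%:R))^-1 * c - noise_stat B eps n w <= test_stat B eps n sigma a k0 M w.
Proof.
move=> H; apply: lb_le_inf; first by exact: (image_nonempty _ (ex_intro _ _ calA0)).
move=> _ [A Ak <-]; rewrite residualE noise_statE mulrDr lerBlDr.
set s := (Num.sqrt _)^-1; have s0 : 0 <= s by rewrite invr_ge0 sqrtr_ge0.
have := H A Ak; set x := _ + 2 * _ => hx.
set y := s * \sum_e _.
apply: (@le_trans _ _ (s * x)); first by apply: ler_wpM2l.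
have := ler_norm (s * x + y); have := ler_norm (- y); rewrite normrN; lra.
Qed.

Lemma meas_noise_stat : measurable_fun setT (noise_stat B eps n).
Proof.
rewrite /noise_stat; apply: measurable_funM => //.
apply: measurableT_comp => //.
apply: measurable_sum => i; apply: measurable_sum => j.
apply: measurable_funM.
  by apply: (measurableT_comp (f := fun b : bool => (b : nat)%:R : R)) => //; exact: measurable_funP.
by apply: measurable_funB => //; apply: measurable_funX; exact: measurable_funP.
Qed.

Lemma type1_risk_le u c : 0 <= c ->
  (P [set w | (u < noise_stat B eps n w)%R] <= c%:E)%E ->
  type1_risk B eps n sigma a k0 u <= c.
Proof.
move=> c0 Pc; apply: ge_sup; first exact: (image_nonempty _ (ex_intro _ _ calA0)).
have mN : measurable [set w | u < noise_stat B eps n w].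
  exact: meas_gt meas_noise_stat.
move=> _ [M MA <-]; apply: (@le_trans _ _ (fine (P [set w | (u < noise_stat B eps n w)%R]))).
  apply: expectation_le_prob => // w; rewrite /test !indicE.
  case: (boolP (w \in [set w | u < test_stat _ _ _ _ _ _ _ _])) => /=; rewrite ?inE ?ler0n ?lexx//=.
  by move=> h; rewrite mem_set ?ler01 ?lexx//=; apply: lt_le_trans h _; exact: test_stat_null.
by rewrite -lee_fin fineK// fin_num_measure.
Qed.

End Risks.

(** * Power against a fixed alternative *)

Section Power.
Context {R : realType} {m1 m2 : nat}.
Context {d : measure_display} {T : measurableType d}.
Variable P : probability T R.
Variables (n : nat) (sigma a U : R) (k0 : nat).
Variables (B : 'I_m1 -> 'I_m2 -> {RV P >-> bool}).
Variables (eps : 'I_m1 -> 'I_m2 -> {RV P >-> R}).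
Hypothesis a0 : 0 < a.
Hypothesis U0 : 0 < U.
Hypothesis n0 : (0 < n)%N.
Hypothesis nm : (n <= m1 * m2)%N.
Hypothesis HB : bernoulli_sampling n B eps.
Hypothesis Heps : noise_assumption sigma U eps.
Let p : R := n%:R / (m1 * m2)%:R.

Lemma quadratic_lower_bound (M A : 'M[R]_(m1, m2)) (delta : R)
    (h : {ffun 'I_m1 * 'I_m2 -> bool * bool} -> R) w :
  0 < delta -> delta <= frob_norm (M - A) ->
  (forall (c : R) (x : {ffun 'I_m1 * 'I_m2 -> bool * bool}), `|c| <= 2 * U / delta ->
       \sum_e (p - ((x e).1)%:R) * ((M - A) e.1 e.2 / frob_norm (M - A)) ^+ 2 +
       c * \sum_e sparse_sign (x e) * ((M - A) e.1 e.2 / frob_norm (M - A)) <= h x) ->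
  (forall i j, `|eps i j w| <= U) -> sign_average U B eps h w <= p / 2 -> 0 <= p ->
  p * delta ^+ 2 / 2 <=
    \sum_(e : 'I_m1 * 'I_m2) (B e.1 e.2 w)%:R * (M - A) e.1 e.2 ^+ 2 +
    2 * \sum_(e : 'I_m1 * 'I_m2) (B e.1 e.2 w)%:R * eps e.1 e.2 w * (M - A) e.1 e.2.
Proof.
move=> d0 dnu hA we hw p0; set D := M - A in dnu hA *; set nu := frob_norm D in dnu hA *.
have nu0 : 0 < nu by exact: lt_le_trans dnu.
(* This choice turns the averaged sign term into -2 <B eps, D> / nu^2, the cross term of the
   residuals. It depends on A through nu, hence the uniformity of [h] over |c| <= 2U / delta. *)
pose c : R := - (2 * U / nu).
have cU : `|c| <= 2 * U / delta.
  rewrite normrN ger0_norm ?divr_ge0 ?mulr_ge0 ?(ltW U0) ?(ltW nu0)//.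
  by rewrite ler_wpM2l ?mulr_ge0 ?(ltW U0)// lef_pV2 ?posrE.
have := @sign_average_ge _ _ _ P _ _ n U B eps U0 h (fun e => (D e.1 e.2 / nu) ^+ 2)
  (fun e => D e.1 e.2 / nu) c w (fun e => we e.1 e.2) (fun x => hA c x cU).
move=> /le_trans /(_ hw).
set S1 := \sum_e _ * _ ^+ 2; set S2 := \sum_e _ * (_ / _).
set Q1 := (X in X + 2 * _); set Q2 := (X in _ + 2 * X).
have -> : S1 = p - Q1 / nu ^+ 2.
  have -> : p = p * mxdot D D / nu ^+ 2.
    by rewrite -frob_normE mulfK// expf_neq0// gt_eqF.
  rewrite /S1 /Q1 /mxdot mulr_sumr !mulr_suml -sumrB; apply: eq_bigr => e _.
  by rewrite -/p; field; rewrite gt_eqF.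
have -> : S2 = Q2 / nu by rewrite /S2 /Q2 mulr_suml; apply: eq_bigr => e _; rewrite mulrA.
have -> : p - Q1 / nu ^+ 2 + c / U * (Q2 / nu) = p - (Q1 + 2 * Q2) / nu ^+ 2.
  by rewrite /c; field; rewrite !gt_eqF.
move=> H; have : p / 2 * nu ^+ 2 <= Q1 + 2 * Q2.
  by rewrite -ler_pdivlMr ?exprn_gt0//; lra.
apply: le_trans; rewrite mulrAC ler_wpM2l ?divr_ge0// lerXn2r ?nnegrE// ltW//.
Qed.

(** Acceptance is confined to three measurable events: a null set of unbounded noise, a large noise
    statistic (probability at most c1), a large [sign_average] (at most c2, by Markov). Outside them
    the quadratic part must beat [u] twice, once for the threshold and once for the noise
    statistic. *)
Lemma power_bound (M : 'M[R]_(m1, m2)) (delta u c1 c2 : R)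
    (h : {ffun 'I_m1 * 'I_m2 -> bool * bool} -> R) :
  0 < delta -> (forall A, calA a k0 A -> delta <= frob_norm (M - A)) ->
  (forall x, 0 <= h x) ->
  (forall A (c : R) (x : {ffun 'I_m1 * 'I_m2 -> bool * bool}), calA a k0 A -> `|c| <= 2 * U / delta ->
       \sum_e (p - ((x e).1)%:R) * ((M - A) e.1 e.2 / frob_norm (M - A)) ^+ 2 +
       c * \sum_e sparse_sign (x e) * ((M - A) e.1 e.2 / frob_norm (M - A)) <= h x) ->
  pexp (sign_law p) h <= p / 2 * c2 ->
  (P [set w | (u < noise_stat B eps n w)%R] <= c1%:E)%E ->
  2 * u < (Num.sqrt (2 * n%:R))^-1 * (p * delta ^+ 2 / 2) ->
  fine ('E_P[fun w => (1 - test B eps n sigma a k0 u M w)%R])%E <= c1 + c2.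
Proof.
move=> d0 dA h0 hA Eh Pn ub.
have mm0 : (0 < m1 * m2)%N by exact: leq_trans nm.
have p0 : 0 < p by rewrite divr_gt0 ?ltr0n.
have [N [mN PN subN]] := noise_bounded Heps.
set A1 := [set w | u < noise_stat B eps n w].
pose A2 := [set w | p / 2 <= sign_average U B eps h w].
have mA1 : measurable A1 by apply: meas_gt; exact: meas_noise_stat.
have bH : bmeas (sign_average U B eps h) by exact: bmeas_sign_average.
have mA2 : measurable A2 by apply: meas_ge; case: bH.
have PA2 : fine (P A2) <= c2.
  have p20 : 0 < p / 2 by rewrite divr_gt0.
  have H0 w : 0 <= sign_average U B eps h w by exact: sign_average_ge0.
  have := markov_mean P p20 bH H0; move/le_trans; apply.
  by rewrite (sign_average_mean U0 nm HB Heps mm0) ler_pdivrMr// [c2 * _]mulrC.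
have fin X : measurable X -> P X \is a fin_num by move=> mX; rewrite fin_num_measure.
have PA1 : fine (P A1) <= c1 by rewrite -lee_fin fineK// fin.
have PU : fine (P (N `|` (A1 `|` A2))) <= c1 + c2.
  have sub2 X Y : measurable X -> measurable Y ->
      fine (P (X `|` Y)) <= fine (P X) + fine (P Y).
    move=> mX mY; rewrite -lee_fin EFinD !fineK; first exact: measureU2.
    - exact: fin.
    - exact: fin.
    - by apply: fin; exact: measurableU.
  have PN0 : fine (P N) = 0 by exact: (congr1 fine PN).
  apply: le_trans (sub2 _ _ mN _) _; first exact: measurableU.
  by rewrite PN0 add0r; apply: le_trans (sub2 _ _ mA1 mA2) _; exact: lerD.
apply: le_trans PU; apply: expectation_le_prob; first by apply: measurableU => //; exact: measurableU.
move=> w; rewrite /test indicE; set S := [set w | _].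
have [wS|wS] := boolP (w \in S); first by rewrite subrr lexx indicE ler0n.
rewrite subr0 ler01 indicE /=; apply/idP.
have [|wA] := pselect ((N `|` (A1 `|` A2)) w); first by move=> wA; rewrite mem_set.
exfalso; move/negP: wS; apply; rewrite inE /S /=.
have wN : ~ N w by move=> ?; apply: wA; left.
have wA1 : noise_stat B eps n w <= u.
  by rewrite leNgt; apply/negP => ?; apply: wA; right; left.
have wA2 : sign_average U B eps h w <= p / 2.
  by rewrite leNgt; apply/negP => ?; apply: wA; right; right; apply: ltW.
have we i j : `|eps i j w| <= U.
  have : ~ (~` [set w | forall i j, `|eps i j w| <= U]) w by move=> /subN.
  by move=> /contrapT /=.
apply: lt_le_trans (test_stat_ge n a0 Heps (c := p * delta ^+ 2 / 2) _); last first.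
  move=> A Ak; apply: (quadratic_lower_bound (h := h)) => //; [exact: dA| |exact: ltW].
  by move=> c x; exact: hA.
by rewrite ltrBrDl; apply: le_lt_trans ub; lra.
Qed.

End Power.

(** * Constants *)

Section Assembly.
Context {R : realType}.

Definition risk_const : R := 2 + 8 * 2 ^+ 60.

(** The right side is a multiple of sqrt (p k0 D), written as p times the critical separation. The
    power 2^60 comes from 2 k0 * 2^118 * 2 p D = 2^120 p k0 D. *)
Lemma numeric_bound (p D q : R) (k0 : nat) : 0 < p -> 1 <= D -> (1 <= k0)%N ->
  q <= 2 * (p * D) -> 0 <= q ->
  2 * Num.sqrt p + 8 * Num.sqrt (2 * k0)%:R * Num.sqrt (2 ^+ 118 * q) <=
  risk_const * (p * Num.sqrt (k0%:R * D / p)).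
Proof.
move=> p0 D1 k1 qD q0.
have k1' : 1 <= k0%:R :> R by rewrite ler1n.
have D0 : 0 <= D by lra.
have kD : 0 <= k0%:R * D by rewrite mulr_ge0 ?ler0n.
have -> : p * Num.sqrt (k0%:R * D / p) = Num.sqrt (p * (k0%:R * D)).
  have pE : p = Num.sqrt (p ^+ 2) by rewrite sqrtr_sqr ger0_norm// ltW.
  rewrite [X in X * _]pE -sqrtrM ?sqr_ge0//.
  by congr Num.sqrt; field; rewrite gt_eqF.
have pkD : 0 <= p * (k0%:R * D) by rewrite mulr_ge0// ltW.
have h1 : Num.sqrt p <= Num.sqrt (p * (k0%:R * D)).
  rewrite ler_sqrt// ler_peMr ?(ltW p0)//.
  by rewrite mulr_ege1.
have h2 : Num.sqrt (2 * k0)%:R * Num.sqrt (2 ^+ 118 * q) <=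
    2 ^+ 60 * Num.sqrt (p * (k0%:R * D)).
  rewrite -sqrtrM ?ler0n//.
  have -> : 2 ^+ 60 = Num.sqrt (2 ^+ 120) :> R.
    by rewrite -[120%N]/(60 * 2)%N exprM sqrtr_sqr ger0_norm// exprn_ge0.
  rewrite -sqrtrM ?exprn_ge0// ler_sqrt; last by rewrite mulr_ge0 ?exprn_ge0.
  have -> : 2 ^+ 120 = 4 * 2 ^+ 118 :> R by rewrite (exprD 2 2 118) -(natrX _ 2 2).
  rewrite natrM; set c := 2 ^+ 118; have c0 : 0 <= c by exact: exprn_ge0.
  have -> : 2 * k0%:R * (c * q) = (2 * c * k0%:R) * q by ring.
  have -> : 4 * c * (p * (k0%:R * D)) = (2 * c * k0%:R) * (2 * (p * D)) by ring.
  by rewrite ler_wpM2l// !mulr_ge0.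
rewrite /risk_const [leRHS]mulrDl; apply: lerD; first by rewrite ler_wpM2l.
by rewrite -[leLHS]mulrA -[leRHS]mulrA ler_wpM2l.
Qed.

End Assembly.

(* [u alpha sigma U] is the quantile constant u_alpha. *)
Theorem theorem5p1 (R : realType) (u : R -> R -> R -> R)
    (alpha a U sigma : R) :
  0 < a -> 0 < U -> 0 < sigma ->
  exists2 C : R, 0 < C &
  forall (m1 m2 n k0 k : nat) (rho : R)
    (d : measure_display) (T : measurableType d) (P : probability T R)
    (B : 'I_m1 -> 'I_m2 -> {RV P >-> bool})
    (eps : 'I_m1 -> 'I_m2 -> {RV P >-> R}),
  12 * expR (- 100 * (m1 + m2)%:R) <= alpha ->
  (1 <= k0)%N -> (k0 < k)%N -> (k <= minn m1 m2)%N ->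
  (n <= m1 * m2)%N ->
  (minn m1 m2)%:R * ln ((m1 + m2)%:R : R) <= n%:R ->
  bernoulli_sampling n B eps ->
  noise_assumption sigma U eps ->
  (P [set w | (u alpha sigma U < noise_stat B eps n w)%R]
     <= (alpha / 3)%:E)%E ->
  C * (m1%:R * m2%:R * k0%:R * (m1 + m2)%:R / n%:R) <= rho ^+ 2 ->
  type1_risk B eps n sigma a k0 (u alpha sigma U) +
  type2_risk B eps n sigma a k0 k (u alpha sigma U) rho <= alpha.
Proof.
move=> a0 U0 s0; set v := u alpha sigma U.
(* [c3] makes Markov's bound equal to alpha / 3 at the critical separation, and 8 [|v|] pays for
   twice the threshold; the 1 makes that comparison strict and [C] positive for every real
   [alpha]. *)
pose c3 := 3 * (16 * a + 4 * U) * risk_const / alpha.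
have C0 : 0 < 1 + 8 * `|v| + c3 ^+ 2.
  by have := normr_ge0 v; have := sqr_ge0 c3; lra.
exists (1 + 8 * `|v| + c3 ^+ 2) => //.
move=> m1 m2 n k0 k rho d T P B eps al k01 k0k km nm hn HB Heps Pn hrho.
have alpha0 : 0 < alpha by apply: lt_le_trans al; rewrite mulr_gt0// expR_gt0.
have m2' : (2 <= minn m1 m2)%N by apply: leq_trans km; apply: leq_trans k0k.
have [p0 p1 [t [pm1 pm2 pq qd]]] := sampling_numeric m2' nm hn.
case: m1 m2 B eps al km nm hn HB Heps Pn hrho m2' p0 p1 pm1 pm2 pq qd => [|m1] [|m2] //.
move=> B eps al km nm hn HB Heps Pn hrho m2'; set p := n%:R / _ => p0 p1 pm1 pm2 pq qd.
have mm0 : 0 < (m1.+1 * m2.+1)%:R :> R by rewrite ltr0n.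
have n0 : (0 < n)%N.
  by rewrite -(ltr0n R); move: p0; rewrite /p pmulr_lgt0 ?invr_gt0.
have a30 : 0 <= alpha / 3 by rewrite divr_ge0// ltW.
have T1 := type1_risk_le k0 a0 Heps a30 Pn.
suff T2 : type2_risk B eps n sigma a k0 k v rho <= alpha / 3 + alpha / 3 by lra.
rewrite /type2_risk.
(* With no matrix in the alternative, the real supremum takes its default value 0. *)
have [->|/set0P[M0 M0alt]] := eqVneq (alternative a k0 k rho : set 'M[R]_(m1.+1, m2.+1)) set0.
  by rewrite image_set0 sup0 addr_ge0.
apply: ge_sup; first by exists (fine ('E_P[fun w => (1 - test B eps n sigma a k0 v M0 w)%R])%E); exists M0.
move=> _ [M [MA Mrho] <-].
set delta := frob_dist M (calA a k0) in Mrho.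
set D : R := (m1.+1 + m2.+1)%:R in qd.
have D1 : 1 <= D by rewrite ler1n.
have D0 : 0 < D by exact: lt_le_trans D1.
have k0r : 0 < k0%:R :> R by rewrite ltr0n.
have kDp : 0 < k0%:R * D / p by rewrite divr_gt0// mulr_gt0.
have hd2 : (1 + 8 * `|v| + c3 ^+ 2) * (k0%:R * D / p) <= delta ^+ 2.
  apply: le_trans Mrho; apply: le_trans hrho; rewrite ler_wpM2l ?(ltW C0)//.
  rewrite le_eqVlt; apply/orP; left; apply/eqP.
  by rewrite /p invfM invrK natrM /D; ring.
have fdn : [set frob_norm (M - A) | A in calA a k0] !=set0.
  by exists (frob_norm (M - 0)); exists 0 => //; exact: calA0.
have fd0 : lbound [set frob_norm (M - A) | A in calA a k0] 0.
  by move=> _ [A _ <-]; exact: frob_norm_ge0.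
have dge0 : 0 <= delta by exact: lb_le_inf.
have d0 : 0 < delta.
  rewrite lt_neqAle dge0 andbT; apply/eqP => dz.
  by have := lt_le_trans (mulr_gt0 C0 kDp) hd2; rewrite -dz expr0n ltxx.
have dA A : calA a k0 A -> delta <= frob_norm (M - A).
  by move=> Ak; apply: ge_inf; [exists 0|exists A].
have [h [h0 hA Eh]] := discrete_bound p0 p1 pm1 pm2 pq a0 U0 d0 MA (erefl delta).
apply: (power_bound a0 U0 n0 nm HB Heps d0 dA h0 hA) => //.
- apply: le_trans Eh _.
  have K0 : 0 <= risk_const :> R by rewrite addr_ge0 ?mulr_ge0 ?exprn_ge0.
  have aU : 0 <= (8 * a + 2 * U) / delta by rewrite divr_ge0// addr_ge0 ?mulr_ge0 ?ltW.
  apply: (@le_trans _ _ ((8 * a + 2 * U) / delta * (risk_const * (p * Num.sqrt (k0%:R * D / p))))).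
    by rewrite ler_wpM2l//; apply: numeric_bound => //; rewrite ler0n.
  set s := Num.sqrt _; have ss : 0 <= s := sqrtr_ge0 _.
  have s2 : s ^+ 2 = k0%:R * D / p by rewrite sqr_sqrtr// ltW.
  have c30 : 0 <= c3 by rewrite divr_ge0 ?(ltW alpha0)// mulr_ge0// mulr_ge0// addr_ge0 ?mulr_ge0 ?ltW.
  have cs : c3 * s <= delta.
    have cs0 : 0 <= c3 * s by exact: mulr_ge0.
    have : (c3 * s) ^+ 2 <= delta ^+ 2.
      rewrite exprMn s2; apply: le_trans hd2.
      by rewrite ler_wpM2r ?(ltW kDp)//; have := normr_ge0 v; lra.
    by rewrite ler_sqr.
  rewrite mulrAC ler_pdivrMr//.
  have -> : (8 * a + 2 * U) * (risk_const * (p * s)) = p / 2 * (alpha / 3) * (c3 * s).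
    by rewrite /c3; field; rewrite gt_eqF.
  by rewrite ler_wpM2l// !mulr_ge0 ?invr_ge0 ?(ltW p0) ?(ltW alpha0).
(* 2n <= 4 m1 m2 <= (m1 + m2)^2; so the normalization of the statistic is absorbed by the factor d
   in the separation. *)
have sn : Num.sqrt (2 * n%:R) <= D.
  rewrite -ler_sqr ?nnegrE ?sqrtr_ge0 ?(ltW D0)// sqr_sqrtr ?mulr_ge0 ?ler0n//.
  rewrite -(natrM _ 2 n) -natrX ler_nat.
  by apply: leq_trans (nat_AGM2 m1.+1 m2.+1).1; exact: leq_mul.
have sn0 : 0 < Num.sqrt (2 * n%:R) :> R by rewrite sqrtr_gt0 mulr_gt0 ?ltr0n.
rewrite ltr_pdivlMl//.
have pd2 : (1 + 8 * `|v|) * D <= p * delta ^+ 2.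
  have : p * ((1 + 8 * `|v| + c3 ^+ 2) * (k0%:R * D / p)) <= p * delta ^+ 2.
    by rewrite ler_wpM2l ?(ltW p0).
  apply: le_trans.
  have -> : p * ((1 + 8 * `|v| + c3 ^+ 2) * (k0%:R * D / p)) =
     (1 + 8 * `|v| + c3 ^+ 2) * (k0%:R * D) by field; rewrite gt_eqF.
  have := normr_ge0 v; have := sqr_ge0 c3 => h1 h2.
  apply: ler_pM; [lra|exact: ltW|lra|].
  by rewrite ler_peMl ?(ltW D0)// ler1n.
apply: (@le_lt_trans _ _ (2 * `|v| * D)).
  apply: (@le_trans _ _ (Num.sqrt (2 * n%:R) * (2 * `|v|))).
    by rewrite ler_wpM2l ?sqrtr_ge0// ler_wpM2l// ler_norm.
  by rewrite mulrC ler_wpM2l// mulr_ge0.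
have vD := mulr_ge0 (normr_ge0 v) (ltW D0).
suff : 2 * `|v| * D < p * delta ^+ 2 / 2 by [].
clear - vD D0 pd2; move: (p * _) pd2 => z; lra.
Qed.
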